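(* Let $d=1$, let $a\in\mathbb R$, $b\in[a,\infty)$, a measure $\mu\colon\mathcal B([a,b])\to[0,\infty]$, and a bounded measurable $f\colon[a,b]\to\mathbb R$ be given, let $\sigma\colon\mathbb R\to\mathbb R$ satisfy $\sigma(x)=\max\{x,0\}$ for all $x\in\mathbb R$, let $D_h$, $\mathcal N_h^\theta$, $\mathcal L_h$ (assumed real-valued) be the associated shallow-network objects and let $(\Omega,\mathcal F,\mathbb P)$, $X_n^m$, $Y_n^m$, $M_n^h$, $\mathfrak L_n^h$, $\mathfrak G_n^h$, $\Phi_n^h$, $\Theta_n^h$ ($m,n,h\in\mathbb N_0$) form a generalized stochastic gradient method, all as defined in the context. For every $h\in\mathbb N$ let $\mathbb L^h\colon\mathbb R^{D_h}\to\mathbb R$ satisfy $\mathbb L^h(\theta)=\mathbb E[|\mathcal N_h^\theta(X_0^0)-Y_0^0|^2]$ for all $\theta\in\mathbb R^{D_h}$. Assume that $f$ is Lipschitz continuous, assume $\mathbb P$-a.s. that $\mathbb E[Y_0^0\mid X_0^0]=f(X_0^0)$, assume $\mathbb P(X_0^0\in B)=\mu(B)$ for all $B\in\mathcal B([a,b])$, assume for all $h\in\mathbb N$ that $\Theta_0^{h,i}$, $i\in\{1,\dots,2h\}$, are independent, let $q\colon\mathbb R\to[0,\infty)$ be measurable, let $\eta\in(0,\infty)$ satisfy $(-\eta,\eta)\subseteq q^{-1}((0,\infty))$, let $\kappa\in\mathbb R$ satisfy for all $h\in\mathbb N$, $i\in\{1,\dots,2h\}$, $x\in\mathbb R$ that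 $\mathbb P(h^\kappa\Theta_0^{h,i}<x)=\int_{-\infty}^xq(y)\,dy$, and assume for all $h\in\mathbb N$ that $\mathbb E[|f(X_0^0)-Y_0^0|^2]\notin\mathbb L^h(\mathbb R^{D_h})$ (the range of $\mathbb L^h$). Then there exists $\delta\in(0,\infty)$ such that for all $h\in\mathbb N$ $$\mathbb P\Bigl(\liminf_{n\to\infty}\mathbb L^h(\Theta_n^h)=\inf_{\theta\in\mathbb R^{D_h}}\mathbb L^h(\theta)\Bigr)\le\delta^{-1}e^{-\delta h}.$$
   Context: Shallow networks (with $d=1$). For $h\in\mathbb N_0$ let $D_h=3h+1$, and for $\theta\in\mathbb R^{D_h}$ let $\mathcal N_h^\theta\colon\mathbb R\to\mathbb R$, $$\mathcal N_h^\theta(x)=\theta_{3h+1}+\sum_{i=1}^h\theta_{2h+i}\,\sigma(\theta_{h+i}+\theta_ix),$$ and $\mathcal L_h(\theta)=\int_{[a,b]}(\mathcal N_h^\theta(x)-f(x))^2\,\mu(dx)$, where $\mathcal L_h\colon\mathbb R^{D_h}\to\mathbb R$ is assumed real-valued for every $h\in\mathbb N_0$. Generalized stochastic gradient method. $(\Omega,\mathcal F,\mathbb P)$ is a probability space; for $m,n\in\mathbb N_0$, $X_n^m\colon\Omega\to[a,b]$ and $Y_n^m\colon\Omega\to\mathbb R$ are random variables. For every $h,n\in\mathbb N_0$: $M_n^h\in\mathbb N$; $\mathfrak L_n^h\colon\mathbb R^{D_h}\times\Omega\to\mathbb R$ is $\mathfrak L_n^h(\theta)=\frac1{M_n^h}\sum_{m=1}^{M_n^h}|\mathcal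 N_h^\theta(X_n^m)-Y_n^m|^2$; $\mathfrak G_n^h=(\mathfrak G_n^{h,1},\dots,\mathfrak G_n^{h,D_h})\colon\mathbb R^{D_h}\times\Omega\to\mathbb R^{D_h}$ is a function such that for all $i\in\{1,\dots,h\}$, $j\in\{i,h+i\}$, $\theta\in\mathbb R^{D_h}$ and all $\omega\in\Omega$ for which $\mathbb R^2\ni(\psi_1,\psi_2)\mapsto\mathfrak L_n^h(\theta_1,\dots,\theta_{i-1},\psi_1,\theta_{i+1},\dots,\theta_{h+i-1},\psi_2,\theta_{h+i+1},\dots,\theta_{D_h},\omega)$ is differentiable at $(\theta_i,\theta_{h+i})$ one has $\mathfrak G_n^{h,j}(\theta,\omega)=(\frac{\partial}{\partial\theta_j}\mathfrak L_n^h)(\theta,\omega)$; $\Theta_n^h=(\Theta_n^{h,1},\dots,\Theta_n^{h,D_h})\colon\Omega\to\mathbb R^{D_h}$ is a random variable; $\Phi_n^h=(\Phi_n^{h,1},\dots,\Phi_n^{h,D_h})\colon(\mathbb R^{D_h})^{n+1}\to\mathbb R^{D_h}$ is a function such that for all $g=((g_{i,j})_{j\in\{1,\dots,D_h\}})_{i\in\{0,\dots,n\}}\in(\mathbb R^{D_h})^{n+1}$ and $j\in\{1,\dots,D_h\}$ with $\sum_{i=0}^n|g_{i,j}|=0$ one has $\Phi_n^{h,j}(g)=0$; and $\Theta_{n+1}^h=\Theta_n^h-\Phi_n^h(\mathfrak G_0^h(\Theta_0^h),\mathfrak G_1^h(\Theta_1^h),\dots,\mathfrak G_n^h(\Theta_n^h))$,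 where $\mathfrak G_n^h(\Theta_n^h)$ means $\omega\mapsto\mathfrak G_n^h(\Theta_n^h(\omega),\omega)$. *)

(* Defs.v *)
From HB Require Import structures.
From mathcomp Require Export all_boot all_order all_algebra.
From mathcomp Require Export all_classical all_reals all_analysis.

Export Order.TTheory GRing.Theory Num.Theory.
Export numFieldNormedType.Exports.

Set Implicit Arguments.
Unset Strict Implicit.
Unset Printing Implicit Defensive.

Local Open Scope classical_set_scope.
Local Open Scope ring_scope.

(** Parameters of a network with [h] hidden neurons are row vectors of length
    [D h]. The one-based coordinates [i], [h + i], [2h + i] and [3h + 1] of the
    mathematical text (with [1 <= i <= h]) become the zero-based indices
    [in_weight i], [in_bias i], [out_weight i] and [out_bias] below. *)
Definition D (h : nat) : nat := (3 * h).+1.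

Definition in_weight h (i : 'I_h) : 'I_(D h) := inord i.
Definition in_bias h (i : 'I_h) : 'I_(D h) := inord (h + i).
Definition out_weight h (i : 'I_h) : 'I_(D h) := inord (2 * h + i).
Definition out_bias h : 'I_(D h) := inord (3 * h).

Definition inner_param h (i : 'I_(2 * h)) : 'I_(D h) := inord i.

Section Network.
Context {R : realType}.
Implicit Types (sigma : R -> R) (h : nat).

Definition network sigma h (theta : 'rV[R]_(D h)) (x : R) : R :=
  theta 0 (out_bias h) + \sum_(i < h)
    theta 0 (out_weight i) *
    sigma (theta 0 (in_bias i) + theta 0 (in_weight i) * x).

(** The measure [mu] lives on the whole line, but only its trace on [[a, b]]
    enters: every measure on the Borel sets of [[a, b]] is such a trace. *)
Definition risk sigma (a b : R) (mu : {measure set R -> \bar R}) (f : R -> R)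
    h (theta : 'rV[R]_(D h)) : \bar R :=
  (\int[mu]_(x in `[a, b]) ((network sigma theta x - f x) ^+ 2)%:E)%E.

Definition replace2 n (theta : 'rV[R]_n) (i j : 'I_n) (psi : R * R) :
    'rV[R]_n :=
  \row_k if k == i then psi.1 else if k == j then psi.2 else theta 0 k.

Definition partial n (F : 'rV[R]_n -> R) (j : 'I_n) (theta : 'rV[R]_n) : R :=
  'D_(delta_mx 0 j) F theta.

(** [X m] and [Y m] are the data points of one gradient step, and [M] is the
    batch size, so that the samples used are [m = 1, ..., M]. *)
Definition empirical_risk sigma (T : Type) (X Y : nat -> T -> R) (M : nat)
    h (theta : 'rV[R]_(D h)) (w : T) : R :=
  M%:R^-1 * \sum_(1 <= m < M.+1) `|network sigma theta (X m w) - Y m w| ^+ 2.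

End Network.

Section Probability.
Context {R : realType} {d : measure_display} {T : measurableType d}.
Context (P : probability T R).

(** Measurability with respect to the Borel sets of [R^(n+1)]. *)
Definition random_vector n (Z : T -> 'rV[R]_n.+1) : Prop :=
  measurable_fun setT (Z : T -> g_sigma_algebraType (@open 'rV[R]_n.+1)).

Definition independent_family (I : finType) (Z : I -> T -> R) : Prop :=
  forall (J : {set I}) (B : I -> set R),
    (forall i, i \in J -> measurable (B i)) ->
    P (\bigcap_(i in [set` J]) (Z i @^-1` B i)) =
    (\prod_(i in J) P (Z i @^-1` B i))%E.

(** [Z] is a version of the conditional expectation of [Y] given [X]; the second
    clause says that [Z] is measurable with respect to [sigma(X)]. *)
Definition is_cond_exp (Y X Z : T -> R) : Prop :=
  [/\ P.-integrable setT (EFin \o Y),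
      preimage_set_system setT Z measurable `<=`
        preimage_set_system setT X measurable,
      P.-integrable setT (EFin \o Z) &
      forall B : set R, measurable B ->
        (\int[P]_(w in X @^-1` B) (Z w)%:E =
         \int[P]_(w in X @^-1` B) (Y w)%:E)%E].

(** Almost surely [E[Y | X] = Z]. *)
Definition cond_exp_ae_eq (Y X Z : T -> R) : Prop :=
  exists2 V : T -> R, is_cond_exp Y X V & {ae P, forall w, V w = Z w}.

End Probability.

(* Main.v *)
(** Proof idea. A neuron whose preactivation is negative at both ends of [[a, b]] is
    dead: the empirical risks do not depend locally on its inner parameters, so all
    generalized gradients vanish there and the neuron never moves again. By
    independence, all but an exponentially small part of the initializations have at
    least nine dead neurons.

    Let [S] be the support of the law of [X]. If [f] agreed on [S] with a continuous
    piecewise linear function, then a network would attain [E|f(X) - Y|^2]; hence, by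
    a greedy argument, [S] contains [h + 1] consecutive triples of points on which
    [f] is not affine. A network with [h] neurons has at most [h] breakpoints, so it is
    affine on an interval around one of these triples. Three narrow hats near this
    triple (nine ReLUs) have a combination orthogonal to all affine functions but not to
    [f], and adding a multiple of it lowers the risk by an amount depending on the triple
    only. Nine dead neurons can be reassigned to produce this combination, so the risk of
    every network with nine dead neurons exceeds the infimum by a fixed amount. *)
Require Import Defs.
From mathcomp Require Import measurable_realfun ring lra zify.

Set Implicit Arguments.
Unset Strict Implicit.
Unset Printing Implicit Defensive.

Local Open Scope classical_set_scope.
Local Open Scope ring_scope.

(** * Continuous piecewise linear functions *)

Section Splines.
Context {R : realType}.
Implicit Types (p f : R -> R) (S : set R).

(** A pair holds a change of slope and a breakpoint, so each entry is one ReLU with inner weight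
    [1]. *)
Definition kinks (s : seq (R * R)) (x : R) : R :=
  \sum_(k <- s) k.1 * Num.max (x - k.2) 0.

(** Such a function is constant near minus infinity; on a half-line bounded below, a kink at the
    left end provides any initial slope. *)
Definition spline p := exists c s, p = fun x => c + kinks s x.

Lemma kinks_cons k s x :
  kinks (k :: s) x = k.1 * Num.max (x - k.2) 0 + kinks s x.
Proof. by rewrite /kinks big_cons. Qed.

Lemma kinks_nil x : kinks [::] x = 0.
Proof. by rewrite /kinks big_nil. Qed.

Lemma spline_cst c : spline (fun=> c).
Proof. by exists c, [::]; apply/funext => x; rewrite kinks_nil addr0. Qed.

Lemma splineD p1 p2 : spline p1 -> spline p2 -> spline (fun x => p1 x + p2 x).
Proof.
move=> [c1 [s1 ->]] [c2 [s2 ->]]; exists (c1 + c2), (s1 ++ s2).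
by apply/funext => x; rewrite /kinks big_cat /= addrACA.
Qed.

Lemma splineZ v p : spline p -> spline (fun x => v * p x).
Proof.
move=> [c [s ->]]; exists (v * c), [seq (v * k.1, k.2) | k <- s].
apply/funext => x; rewrite /kinks big_map mulrDr mulr_sumr; congr (_ + _).
by apply: eq_bigr => k _; rewrite mulrA.
Qed.

Lemma spline_kink k : spline (fun x => Num.max (x - k) 0).
Proof.
exists 0, [:: (1, k)]; apply/funext => x.
by rewrite kinks_cons kinks_nil mul1r addr0 add0r.
Qed.

Lemma spline_comp p (g : R -> R) :
  (forall k, spline (fun x => Num.max (g x - k) 0)) ->
  spline p -> spline (fun x => p (g x)).
Proof.
move=> gk [c [s ->]]; apply: splineD (spline_cst _) _.
elim: s => [|k s IHs].
  rewrite (_ : (fun x => _) = fun=> 0); first exact: spline_cst.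
  by apply/funext => x; rewrite kinks_nil.
rewrite (_ : (fun x => _) = fun x => k.1 * Num.max (g x - k.2) 0 + kinks s (g x)).
  by apply: splineD IHs; apply: splineZ.
by apply/funext => x; rewrite kinks_cons.
Qed.

Lemma spline_max t p : spline p -> spline (fun x => p (Num.max x t)).
Proof.
apply: spline_comp => k; have [kt|tk] := leP k t.
  rewrite (_ : (fun x => _) = fun x => (t - k) + Num.max (x - t) 0).
    exact: splineD (spline_cst _) (spline_kink _).
  apply/funext => x; rewrite /Num.max.
  by case: (ltP x t) => ?; case: ltP => ?; case: ltP => ?; lra.
rewrite (_ : (fun x => _) = fun x => Num.max (x - k) 0); first exact: spline_kink.
apply/funext => x; rewrite /Num.max.
by case: (ltP x t) => ?; case: ltP => ?; try case: ltP => ?; lra.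
Qed.

Lemma spline_min t p : spline p -> spline (fun x => p (Num.min x t)).
Proof.
apply: spline_comp => k; have [kt|tk] := leP k t.
  rewrite (_ : (fun x => _) = fun x => Num.max (x - k) 0 + -1 * Num.max (x - t) 0).
    by apply: splineD (spline_kink _) _; apply: splineZ; exact: spline_kink.
  apply/funext => x; rewrite /Num.max /Num.min.
  by case: (ltP x t) => ?; case: (ltP (_ - k)) => ?; case: ltP => ?;
    try case: ltP => ?; lra.
rewrite (_ : (fun x => _) = fun=> 0); first exact: spline_cst.
apply/funext => x; rewrite /Num.max /Num.min.
by case: (ltP x t) => ?; case: ltP => ?; lra.
Qed.

Lemma spline_continuous p : spline p -> continuous p.
Proof.
move=> [c [s ->]] x; apply: cvgD; first exact: cvg_cst.
elim: s => [|k s IHs].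
  rewrite (_ : kinks [::] = fun=> 0); first exact: cvg_cst.
  by apply/funext => y; rewrite kinks_nil.
rewrite (_ : kinks _ = fun x => k.1 * Num.max (x - k.2) 0 + kinks s x); last first.
  by apply/funext => y; rewrite kinks_cons.
apply: cvgD IHs; apply: cvgM; first exact: cvg_cst.
apply: (@continuous_max _ _ (fun y : R => y - k.2) (fun=> 0)); last exact: cvg_cst.
by apply: cvgB; [exact: cvg_id|exact: cvg_cst].
Qed.

(** [p1] is frozen after [t], [p2] is frozen before [s], and a ramp between [t] and [s] carries one
    value to the other. *)
Lemma spline_glue p1 p2 t s : spline p1 -> spline p2 -> t <= s ->
  (t = s -> p1 t = p2 s) ->
  exists p, [/\ spline p, forall x, x <= t -> p x = p1 x &
                          forall x, s <= x -> p x = p2 x].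
Proof.
move=> sp1 sp2 ts teq; set m := (p2 s - p1 t) / (s - t).
exists (fun x => p1 (Num.min x t) + (p2 (Num.max x s) + (- p2 s +
   (m * Num.max (x - t) 0 + (- m) * Num.max (x - s) 0)))); split.
- apply: splineD; first exact: spline_min.
  apply: splineD; first exact: spline_max.
  apply: splineD; first exact: spline_cst.
  by apply: splineD; apply: splineZ; exact: spline_kink.
- move=> x xt; rewrite (min_idPl xt) (max_idPr (le_trans xt ts)).
  rewrite (@max_idPr _ _ _ 0 _) ?subr_le0// (@max_idPr _ _ _ 0 _).
    by ring.
  by rewrite subr_le0 (le_trans xt).
- move=> x sx; rewrite (min_idPr (le_trans ts sx)) (max_idPl sx).
  rewrite !(max_idPl _) ?subr_ge0// ?(le_trans ts)//.
  have [ets|nts] := eqVneq t s.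
    by rewrite /m (teq ets) subrr; ring.
  have st0 : s - t != 0 by rewrite subr_eq0 eq_sym.
  by rewrite /m; field.
Qed.

Lemma eq_on_closure p f S x : continuous p -> continuous f ->
  (forall y, S y -> p y = f y) -> closure S x -> p x = f x.
Proof.
move=> cp cf pf Sx.
have cl : closed [set y | p y - f y = 0].
  apply: (@preimage_closed _ _ (fun y => p y - f y) [set 0]) => [y _|].
    by apply: cvgB; [exact: cp|exact: cf].
  exact: closed_eq.
apply/eqP; rewrite -subr_eq0; apply/eqP.
have /closureS : S `<=` [set y | p y - f y = 0].
  by move=> y Sy /=; rewrite pf// subrr.
by move=> /(_ x Sx); rewrite -(closure_id _).1.
Qed.

Lemma closure_inf S : S !=set0 -> has_lbound S -> closure S (inf S).
Proof.
move=> S0 lS; have hS : has_inf S by [].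
move=> B /nbhs_ballP[e /= e0 eB].
have [y Sy yle] := inf_adherent e0 hS.
exists y; split => //; apply: eB; rewrite /ball/= distrC ger0_norm.
  by rewrite ltrBlDr addrC.
by rewrite subr_ge0; exact: ge_inf.
Qed.

(** * Triples on which the target is not affine *)

Variable f : R -> R.
Hypothesis cf : continuous f.

Definition collinear (s1 s2 s3 : R) :=
  (f s2 - f s1) * (s3 - s2) = (f s3 - f s2) * (s2 - s1).

Definition affine_on S := forall s1 s2 s3, S s1 -> S s2 -> S s3 ->
  s1 < s2 -> s2 < s3 -> collinear s1 s2 s3.

Lemma affine_on_spline S u : S `<=` `]u, +oo[ -> affine_on S ->
  exists2 p, spline p & forall x, S x -> p x = f x.
Proof.
move=> Su aS; have [S0|] := pselect (S !=set0); last first.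
  move=> S0; exists (fun=> 0); first exact: spline_cst.
  by move=> x Sx; exfalso; apply: S0; exists x.
have [[x [y [Sx Sy xy]]]|nxy] := pselect (exists x y, [/\ S x, S y & x < y]);
    last first.
  have [x Sx] := S0; exists (fun=> f x); first exact: spline_cst.
  move=> y Sy; have [|yx|->//] := ltgtP x y => [xy|].
    by exfalso; apply: nxy; exists x, y.
  by exfalso; apply: nxy; exists y, x.
set m := (f y - f x) / (y - x).
(* The line through the graph points at [x] and [y], with its kink at [u], to the left of all of
   [S]. *)
exists (fun z => (f x + m * (u - x)) + m * Num.max (z - u) 0).
  by apply: splineD; [exact: spline_cst|apply: splineZ; exact: spline_kink].
move=> z Sz; have := Su z Sz; rewrite /= in_itv/= andbT => uz.
rewrite (max_idPl _) ?subr_ge0 ?ltW//.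
have xy0 : y - x != 0 by rewrite subr_eq0 gt_eqF.
have -> : f x + m * (u - x) + m * (z - u) = f x + m * (z - x) by ring.
apply/eqP; rewrite -subr_eq0; apply/eqP.
apply: (mulIf xy0); rewrite mul0r.
have -> : (f x + m * (z - x) - f z) * (y - x) =
          (f y - f x) * (z - x) + (f x - f z) * (y - x) by rewrite /m; field.
case: (ltgtP z x) => [zx|xz|->]; last by ring.
  by have := aS _ _ _ Sz Sx Sy zx xy; rewrite /collinear => ?; lra.
case: (ltgtP z y) => [zy|yz|->]; last by ring.
  by have := aS _ _ _ Sx Sz Sy xz zy; rewrite /collinear => ?; lra.
by have := aS _ _ _ Sx Sy Sz xy yz; rewrite /collinear => ?; lra.
Qed.

(** Each triple begins strictly after the previous one ends, so the spans of the triples are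
    disjoint. *)
Fixpoint chain S u n : Prop := if n is n'.+1 then
  exists s1 s2 s3, [/\ [/\ S s1, S s2 & S s3], u < s1, s1 < s2, s2 < s3 &
    ~ collinear s1 s2 s3 /\ chain S s3 n'] else True.

Lemma chain_le S u v n : u <= v -> chain S v n -> chain S u n.
Proof.
case: n => //= n uv [s1 [s2 [s3 [? us ? ? ?]]]]; exists s1, s2, s3; split=> //.
exact: le_lt_trans us.
Qed.

(** This leaves room to move slightly past [u] without losing the chain. *)
Lemma chain_gt S u n : chain S u n -> exists2 x, u < x & chain S x n.
Proof.
case: n => [_|n [s1 [s2 [s3 [? us ? ? ?]]]]] /=.
  by exists (u + 1) => //; lra.
exists ((u + s1) / 2); first by lra.
by exists s1, s2, s3; split => //; lra.
Qed.

(** The affine piece is first extended to [c], then joined to [p] at the infimum of the points of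
    [S] beyond [c]. Agreement where the pieces meet follows from continuity, and from closedness of
    [S] when that infimum is [c]. *)
Lemma glue_affine S u c p : closed S -> u <= c ->
  affine_on (S `&` `]u, c[) ->
  spline p -> (forall x, S x -> c < x -> p x = f x) ->
  exists2 p', spline p' & forall x, S x -> u < x -> p' x = f x.
Proof.
move=> clS uc aS sp pf.
have clSx A x : A `<=` S -> closure A x -> S x.
  by move=> AS /(closureS AS); rewrite -(closure_id _).1.
(* [c] may be an isolated point of [S], so a ramp leads from the supremum of the points of [S] in
   []u, c[] to the value [f c] at [c]. *)
have [p1 sp1 p1f] : exists2 p1, spline p1 & forall x, S x -> u < x -> x <= c -> p1 x = f x.
  have [l sl lf] := @affine_on_spline (S `&` `]u, c[) u
    (fun x => ltac:(by move=> [_]; rewrite /= !in_itv/= andbT => /andP[])) aS.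
  have [[t0 At0]|A0] := pselect ((S `&` `]u, c[) !=set0); last first.
    exists (fun=> f c); first exact: spline_cst.
    move=> x Sx ux; rewrite le_eqVlt => /predU1P[->//|xc].
    by exfalso; apply: A0; exists x; split => //=; rewrite in_itv/= ux.
  set A := S `&` _ in lf At0 *.
  have ubA : ubound A c by move=> x [_]/=; rewrite in_itv/= => /andP[_ /ltW].
  have cA : closure A (sup A) by apply: closure_sup; [exists t0|exists c].
  have ltf : l (sup A) = f (sup A).
    exact: (eq_on_closure (spline_continuous sl) cf lf cA).
  have tc : sup A <= c by apply: ge_sup => //; exists t0.
  have [p' [sp' p'l p'c]] := @spline_glue l (fun=> f c) (sup A) c sl (spline_cst _) tc
    (fun e => ltac:(by rewrite ltf e)).
  exists p' => // x Sx ux; rewrite le_eqVlt => /predU1P[->|xc]; first exact: p'c.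
  have Ax : A x by split=> //=; rewrite in_itv/= ux.
  by rewrite p'l ?lf//; apply: ub_le_sup => //; exists c.
have [[t0 At0]|A0] := pselect ((S `&` `]c, +oo[) !=set0); last first.
  exists p1 => // x Sx ux; have [xc|cx] := leP x c; first exact: p1f.
  by exfalso; apply: A0; exists x; split => //=; rewrite in_itv/= cx.
set A := S `&` _ in At0.
have pfA x : A x -> p x = f x.
  by move=> [Sx]/=; rewrite in_itv/= andbT => cx; exact: pf.
have lbA : lbound A c by move=> x [_]/=; rewrite in_itv/= andbT => /ltW.
have cA : closure A (inf A) by apply: closure_inf; [exists t0|exists c].
have ptf : p (inf A) = f (inf A).
  exact: (eq_on_closure (spline_continuous sp) cf pfA cA).
have ct : c <= inf A by apply: lb_le_inf => //; exists t0.
have SA : S (inf A) by apply: clSx cA; exact: subIsetl.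
move: uc; rewrite le_eqVlt => /predU1P[uc|uc].
  by exists p => // x Sx ux; apply: pf => //; rewrite -uc.
have [p' [sp' p'l p'c]] : exists p', [/\ spline p',
    forall x, S x -> u < x -> x <= c -> p' x = f x & forall x, inf A <= x -> p' x = p x].
  move: ct; rewrite le_eqVlt => /predU1P[ct|ct].
    have [p' [? e1 e2]] := @spline_glue p1 p c (inf A) sp1 sp ltac:(by rewrite -ct)
      (fun e => ltac:(by rewrite ptf -ct p1f// ct)).
    by exists p'; split => // x Sx ux xc; rewrite e1// p1f.
  have [p' [? e1 e2]] := @spline_glue p1 p c (inf A) sp1 sp (ltW ct)
      (fun e => ltac:(by move: ct; rewrite e ltxx)).
  by exists p'; split => // x Sx ux xc; rewrite e1// p1f.
exists p' => // x Sx ux; have [xc|cx] := leP x c; first exact: p'l.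
have Ax : A x by split => //=; rewrite in_itv/= cx.
by rewrite p'c ?pfA//; apply: ge_inf => //; exists c.
Qed.

Lemma not_affine_on S : ~ affine_on S -> exists s1 s2 s3,
  [/\ [/\ S s1, S s2 & S s3], s1 < s2, s2 < s3 & ~ collinear s1 s2 s3].
Proof.
move=> nS; apply: contrapT => H; apply: nS => s1 s2 s3 S1 S2 S3 s12 s23.
by apply: contrapT => nc; apply: H; exists s1, s2, s3.
Qed.

(* Greedy argument: [c] is the largest point such that [f] is affine on the part
   of [S] between [u] and [c]; a spline to the right of [c] would extend to one
   to the right of [u], so the induction hypothesis applies at [c]. *)
Lemma chain_exists S n u : closed S ->
  ~ (exists2 p, spline p & forall x, S x -> u < x -> p x = f x) ->
  chain S u n.
Proof.
move=> clS; elim: n u => [//|n IHn] u nsp.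
(* If [f] were affine on every bounded part of [S] beyond [u], it would be affine on all of [S]
   beyond [u], contradicting [nsp]. *)
have [y ny] : exists y, ~ affine_on (S `&` `]u, y[).
  apply: contrapT => /forallNP H; apply: nsp.
  have aS : affine_on (S `&` `]u, +oo[).
    move=> s1 s2 s3 [S1 u1] [S2 u2] [S3 u3] s12 s23.
    move: u1 u2 u3; rewrite /= !in_itv/= !andbT => u1 u2 u3.
    have := H (s3 + 1) => /contrapT; apply => //; split => //=; rewrite in_itv/=.
    - by rewrite u1; lra.
    - by rewrite u2; lra.
    - by rewrite u3; lra.
  have [p sp pf] := @affine_on_spline _ u (@subIsetr _ S _) aS.
  by exists p => // x Sx ux; apply: pf; split => //=; rewrite in_itv/= ux.
pose E := [set x | u <= x /\ affine_on (S `&` `]u, x[)].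
have Eu : E u.
  by split => // s1 s2 s3 [_]; rewrite /= in_itv/= => /andP[/lt_trans h /h]; rewrite ltxx.
have Eub : ubound E y.
  move=> x [ux ax]; rewrite leNgt; apply/negP => yx; apply: ny.
  move=> s1 s2 s3 [S1 u1] [S2 u2] [S3 u3]; move: u1 u2 u3.
  rewrite /= !in_itv/= => /andP[u1 v1] /andP[u2 v2] /andP[u3 v3].
  by apply: ax; split => //=; rewrite in_itv/= ?u1 ?u2 ?u3 (lt_trans _ yx).
have hE : has_sup E by split; [exists u|exists y].
set c := sup E; have uc : u <= c by apply: ub_le_sup => //; exists y.
have ac : affine_on (S `&` `]u, c[).
  move=> s1 s2 s3 [S1 u1] [S2 u2] [S3 u3] s12 s23.
  move: u1 u2 u3; rewrite /= !in_itv/= => /andP[u1 _] /andP[u2 _] /andP[u3 v3].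
  have [x [ux ax] s3x] := @sup_adherent _ E (c - s3) ltac:(by rewrite subr_gt0) hE.
  have {}s3x : s3 < x by move: s3x; rewrite /c; lra.
  by apply: ax => //; split => //=; rewrite in_itv/= ?u1 ?u2 ?u3/= //; lra.
have nc : ~ (exists2 p, spline p & forall x, S x -> c < x -> p x = f x).
  by move=> [p sp pf]; apply: nsp; exact: (glue_affine clS uc ac sp pf).
(* Moving to [x > c] keeps the rest of the chain to the right of [x], while the maximality of [c]
   forces a non-collinear triple inside []u, x[]. *)
have [x cx chx] := chain_gt (IHn c nc).
have nx : ~ affine_on (S `&` `]u, x[).
  move=> ax; have Ex : E x by split => //; exact: le_trans uc (ltW cx).
  have := ub_le_sup (ex_intro _ y Eub) Ex; rewrite -/c.
  by rewrite leNgt cx.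
have [s1 [s2 [s3 [[[S1 u1] [S2 u2] [S3 u3]] s12 s23 nco]]]] := not_affine_on nx.
move: u1 u2 u3; rewrite /= !in_itv/= => /andP[u1 _] /andP[u2 _] /andP[u3 v3].
exists s1, s2, s3; split => //; split => //.
exact: chain_le (ltW v3) chx.
Qed.

End Splines.

(** * Lowering the mean squared error near a bend of the target *)

Section Averages.
Context {R : realType} {d : measure_display} {T : measurableType d}.
Variable P : probability T R.
Implicit Types u v : T -> R.

Local Notation rint u := (P.-integrable setT (EFin \o u)).

Lemma rintD u v : rint u -> rint v -> rint (fun w => u w + v w).
Proof.
move=> iu iv; have := integrableD measurableT iu iv.
by apply: eq_integrable.
Qed.

Lemma rintZ k u : rint u -> rint (fun w => k * u w).
Proof.
move=> iu; have := integrableZl measurableT k iu.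
by apply: eq_integrable.
Qed.

Lemma rintM u v (C : R) : measurable_fun setT u -> (forall w, `|u w| <= C) ->
  rint v -> rint (fun w => u w * v w).
Proof.
move=> mu uC iv; have := @integrableMr _ _ _ P _ measurableT u (EFin \o v) mu.
have bu : [bounded u x | x in setT].
  exists C; split; first by rewrite num_real.
  by move=> M CM w _ /=; exact: le_trans (uC w) (ltW CM).
by move=> /(_ bu iv); apply: eq_integrable.
Qed.

Lemma rint_bounded u (C : R) : measurable_fun setT u ->
  (forall w, `|u w| <= C) -> rint u.
Proof.
move=> mu uC; apply: measurable_bounded_integrable => //.
  by rewrite (@le_lt_trans _ _ 1%E) ?probability_le1 ?ltry.
exists C; split; first by rewrite num_real.
by move=> M CM w _ /=; exact: le_trans (uC w) (ltW CM).
Qed.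

Lemma RintegralTD u v : rint u -> rint v ->
  \int[P]_w (u w + v w) = \int[P]_w u w + \int[P]_w v w.
Proof. exact: RintegralD. Qed.

Lemma RintegralTZ k u : rint u -> \int[P]_w (k * u w) = k * \int[P]_w u w.
Proof. exact: RintegralZl. Qed.

Lemma Rintegral_indicM u (A : set T) : measurable A -> rint u ->
  \int[P]_(w in A) u w = \int[P]_w (\1_A w * u w).
Proof.
move=> mA iu; rewrite Rintegral_mkcond; apply: eq_Rintegral => w _.
by rewrite patchE indicE; case: ifP => wA; rewrite ?wA ?mul1r ?mul0r.
Qed.

(** * Random inputs in a compact interval, and hat functions *)

Variables (X : T -> R) (a b : R).
Hypothesis mX : measurable_fun setT X.
Hypothesis Xab : forall w, a <= X w <= b.

(* Halving: with [B = {phi >= 1/2}] one has [phi = (1_B + psi) / 2] with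
   [0 <= psi <= 1], so that the bound on [|E[phi(X) Z]|] halves at each step. *)
Lemma expectation_mul_eq0 (Z : T -> R) (phi : R -> R) : rint Z ->
  (forall B, measurable B -> \int[P]_(w in X @^-1` B) Z w = 0) ->
  measurable_fun setT phi -> (forall x, 0 <= phi x <= 1) ->
  \int[P]_w (phi (X w) * Z w) = 0.
Proof.
move=> iZ Z0 mphi phi01.
have mphiX (psi : R -> R) : measurable_fun setT psi -> measurable_fun setT (psi \o X).
  by move=> ?; exact: measurableT_comp.
have bpsi (psi : R -> R) : (forall x, 0 <= psi x <= 1) -> forall w, `|psi (X w)| <= 1.
  by move=> psi01 w; have /andP[? ?] := psi01 (X w); rewrite ger0_norm.
set C := \int[P]_w `|Z w|.
have H n : forall psi : R -> R, measurable_fun setT psi ->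
    (forall x, 0 <= psi x <= 1) -> `|\int[P]_w (psi (X w) * Z w)| <= C / 2 ^+ n.
  elim: n => [|n IHn] psi mpsi psi01.
    rewrite expr0 divr1; apply: le_trans.
      by apply: le_normr_Rintegral => //; apply: (@rintM _ _ 1) => //; 
        [exact: mphiX|exact: bpsi].
    apply: le_Rintegral => //.
    - have := @rintM _ _ 1 (mphiX _ mpsi) (bpsi _ psi01) iZ.
      move=> /integrable_norm; apply: eq_integrable => //.
    - by have := integrable_norm iZ; apply: eq_integrable.
    - move=> w _; rewrite normrM ler_piMl// bpsi//.
  pose B := [set x | 1 / 2 <= psi x].
  have mB : measurable B.
    rewrite (_ : B = psi @^-1` `[1 / 2, +oo[); last first.
      by apply/seteqP; split => x /=; rewrite in_itv/= andbT.
    by rewrite -[X in measurable X]setTI; apply: mpsi.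
  pose xi := fun x => 2 * psi x - \1_B x.
  have mxi : measurable_fun setT xi.
    apply: measurable_funB; last exact: measurable_indic.
    by apply: measurable_funM => //; exact: measurable_cst.
  have xi01 x : 0 <= xi x <= 1.
    have /andP[? ?] := psi01 x; rewrite /xi indicE.
    case: (boolP (x \in B)) => [|/negP]; rewrite inE /B/=; first by move=> ?; apply/andP; lra.
    by move=> /negP; rewrite -ltNge => ?; apply/andP; lra.
  have mXB : measurable (X @^-1` B) by rewrite -[X in measurable X]setTI; apply: mX.
  have ZB : \int[P]_w (\1_(X @^-1` B) w * Z w) = 0 by rewrite -Rintegral_indicM// Z0.
  have -> : \int[P]_w (psi (X w) * Z w) = 2^-1 * \int[P]_w (xi (X w) * Z w).
    have ixi : rint (fun w => xi (X w) * Z w).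
      by apply: (@rintM _ _ 1) => //; [exact: mphiX|exact: bpsi].
    have iB : rint (fun w => \1_(X @^-1` B) w * Z w).
      apply: (@rintM _ _ 1) => // w.
      by rewrite indicE; case: (_ \in _); rewrite ?normr1 ?normr0.
    rewrite -[RHS]addr0 -[X in _ = _ + X](mulr0 2^-1) -ZB -RintegralTZ// -RintegralTZ// -RintegralTD ?rintZ//.
    apply: eq_Rintegral => w _.
    have -> : \1_(X @^-1` B) w = \1_B (X w) :> R.
      by rewrite !indicE; congr (_%:R); apply/idP/idP; rewrite !inE.
    by rewrite /xi; field.
  rewrite normrM ger0_norm ?invr_ge0//.
  rewrite exprS invfM mulrCA ler_pM2l ?invr_gt0//.
  exact: IHn.
have C0 : 0 <= C by apply: Rintegral_ge0.
apply/eqP; rewrite -normr_le0 leNgt; apply/negP => pos.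
set e := `|_| in pos.
(* This exponent [n] exceeds [C / e], and [2 ^ n > n], so the bound [C / 2 ^ n] falls below [e]. *)
have := H (Num.truncn (C / e)).+1 phi mphi phi01; rewrite -/e.
rewrite leNgt => /negP; apply.
rewrite ltr_pdivrMr ?exprn_gt0// mulrC -ltr_pdivrMr//.
apply: (lt_trans (truncnS_gt _)).
by rewrite -natrX ltr_nat ltn_expl.
Qed.

Lemma continuous_comp_bounded (g : R -> R) : continuous g ->
  exists C, forall w, `|g (X w)| <= C.
Proof.
move=> cg; have : compact (g @` `[a, b]).
  apply: continuous_compact; last exact: segment_compact.
  by apply: continuous_subspaceT.
move=> /compact_bounded[M [_ gM]]; exists (M + 1) => w.
apply: (gM (M + 1)); first by rewrite ltrDl.
by exists (X w) => //=; rewrite in_itv/=.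
Qed.

Lemma measurable_continuous_comp (g : R -> R) : continuous g ->
  measurable_fun setT (fun w => g (X w)).
Proof.
move=> cg; apply: (@measurableT_comp _ _ _ _ _ _ g) => //.
exact: continuous_measurable_fun.
Qed.

Lemma rint_continuous (g : R -> R) : continuous g -> rint (fun w => g (X w)).
Proof.
move=> cg; have [C gC] := continuous_comp_bounded cg.
by apply: rint_bounded gC; exact: measurable_continuous_comp.
Qed.

Lemma rint_continuousM (g : R -> R) u : continuous g -> rint u ->
  rint (fun w => g (X w) * u w).
Proof.
move=> cg; have [C gC] := continuous_comp_bounded cg.
by apply: rintM gC; exact: measurable_continuous_comp.
Qed.

(** The triangle of height [e] over [[s - e, s + e]], written with kinks so that three ReLUs realize
    it. *)
Definition hat (s e : R) := kinks [:: (1, s - e); (-2, s); (1, s + e)].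

Lemma hatE s e x : hat s e x =
  Num.max (x - (s - e)) 0 - 2 * Num.max (x - s) 0 + Num.max (x - (s + e)) 0.
Proof. by rewrite /hat !kinks_cons kinks_nil/=; ring. Qed.

Lemma kinks_continuous (s : seq (R * R)) : continuous (kinks s).
Proof.
apply: spline_continuous; exists 0, s.
by apply/funext => x; rewrite add0r.
Qed.

Lemma hat_bound s e x : 0 < e -> 0 <= hat s e x <= e.
Proof.
move=> e0; rewrite hatE /Num.max; apply/andP.
by case: ltP => ?; case: ltP => ?; case: ltP => ?; lra.
Qed.

Lemma hat_eq0 s e x : 0 < e -> e <= `|x - s| -> hat s e x = 0.
Proof.
move=> e0; rewrite hatE /Num.max ler_normr => /orP.
by case: ltP => ?; case: ltP => ?; case: ltP => ? []; lra.
Qed.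

Lemma hat_ge s e x : 0 < e -> `|x - s| <= e / 2 -> e / 2 <= hat s e x.
Proof.
move=> e0; rewrite hatE /Num.max ler_norml => /andP[].
by case: ltP => ?; case: ltP => ?; case: ltP => ?; lra.
Qed.

(** The topological support of the law of [X]. *)
Definition law_support : set R :=
  [set s | forall e, 0 < e -> P (X @^-1` `]s - e, s + e[) != 0%E].

(** The hat is at least [e / 2] on []s - e / 2, s + e / 2[], which has positive probability. *)
Lemma expectation_hat_gt0 s e : law_support s -> 0 < e ->
  0 < \int[P]_w hat s e (X w).
Proof.
move=> Ss e0; pose B := X @^-1` `]s - e / 2, s + e / 2[.
have mB : measurable B by rewrite -[B]setTI; apply: mX.
have PB : 0 < fine (P B).
  rewrite fine_gt0// lt0e Ss ?divr_gt0//= measure_ge0/=.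
  by rewrite (@le_lt_trans _ _ 1%E) ?probability_le1 ?ltry.
apply: (@lt_le_trans _ _ (e / 2 * \int[P]_w \1_B w)).
  by rewrite mulr_gt0 ?divr_gt0// /Rintegral integral_indic// setIT.
have iB : rint (\1_B : T -> R) by exact: integrable_indic.
rewrite -RintegralTZ//; apply: le_Rintegral => //.
- exact: rintZ.
- by apply: rint_continuous; exact: kinks_continuous.
move=> w _; rewrite indicE; case: (boolP (w \in B)) => [|_].
  rewrite inE /B/= in_itv/= mulr1 => /andP[? ?]; apply: hat_ge => //.
  by rewrite ler_norml; apply/andP; lra.
by rewrite mulr0; have /andP[] := hat_bound s (X w) e0.
Qed.

(** The quotient is an average of [u] with nonnegative weights that vanish outside the event
    [|X w - s| < e]. *)
Lemma hat_average s e c eta u : law_support s -> 0 < e ->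
  (forall w, `|X w - s| < e -> `|u w - c| <= eta) ->
  rint (fun w => hat s e (X w) * u w) ->
  `|(\int[P]_w (hat s e (X w) * u w)) / \int[P]_w hat s e (X w) - c| <= eta.
Proof.
move=> Ss e0 uc iu; have m0 := expectation_hat_gt0 Ss e0.
set m := \int[P]_w hat s e (X w) in m0 *.
have ih : rint (fun w => hat s e (X w)).
  by apply: rint_continuous; exact: kinks_continuous.
have -> : (\int[P]_w (hat s e (X w) * u w)) / m - c =
   (\int[P]_w (hat s e (X w) * u w) + (- c) * m) / m by field; rewrite gt_eqF.
rewrite normrM normfV (gtr0_norm m0) ler_pdivrMr// -RintegralTZ// -RintegralTD ?rintZ//.
have iD := rintD iu (rintZ (- c) ih).
apply: le_trans; first by apply: le_normr_Rintegral => //.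
rewrite /m -RintegralTZ//; apply: le_Rintegral => //.
- by have := integrable_norm iD; apply: eq_integrable.
- exact: rintZ.
move=> w _; have /andP[h0 _] := hat_bound s (X w) e0.
have -> : hat s e (X w) * u w + - c * hat s e (X w) = hat s e (X w) * (u w - c) by ring.
have [h|h] := ltP `|X w - s| e; last by rewrite hat_eq0// mul0r normr0 mulr0.
by rewrite normrM ger0_norm// mulrC ler_wpM2r// uc.
Qed.

(** The bound [t <= 1] lets the product of the two errors be absorbed into a term linear in [t]. *)
Lemma mul_perturb (x x' y y' t : R) : `|x' - x| <= t -> `|y' - y| <= t -> t <= 1 ->
  `|x' * y' - x * y| <= t * (`|x| + `|y| + 1).
Proof.
move=> hx hy t1; have t0 : 0 <= t by exact: le_trans hx.
have -> : x' * y' - x * y = (x' - x) * (y' - y) + x * (y' - y) + (x' - x) * y by ring.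
have h1 : `|(x' - x) * (y' - y)| <= t.
  by rewrite normrM (le_trans (ler_pM _ _ hx hy))// ler_piMl.
have h2 : `|x * (y' - y)| <= t * `|x| by rewrite normrM mulrC ler_wpM2r.
have h3 : `|(x' - x) * y| <= t * `|y| by rewrite normrM ler_wpM2r.
have := ler_normD ((x' - x) * (y' - y) + x * (y' - y)) ((x' - x) * y).
have := ler_normD ((x' - x) * (y' - y)) (x * (y' - y)).
by lra.
Qed.

(** The defect of [collinear], with free ordinates, since it is also evaluated at averages of [X]
    and [Y] rather than at points of the graph of [f]. *)
Definition bend (x1 x2 x3 y1 y2 y3 : R) :=
  (y2 - y1) * (x3 - x2) - (y3 - y2) * (x2 - x1).

Lemma bend_perturb x1 x2 x3 y1 y2 y3 : bend x1 x2 x3 y1 y2 y3 != 0 ->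
  exists2 eta, 0 < eta & forall x1' x2' x3' y1' y2' y3',
    `|x1' - x1| <= eta -> `|x2' - x2| <= eta -> `|x3' - x3| <= eta ->
    `|y1' - y1| <= eta -> `|y2' - y2| <= eta -> `|y3' - y3| <= eta ->
    bend x1' x2' x3' y1' y2' y3' != 0.
Proof.
set D := bend _ _ _ _ _ _ => D0.
set M := (`|y2 - y1| + `|x3 - x2| + 1) + (`|y3 - y2| + `|x2 - x1| + 1).
have M0 : 0 < M.
  rewrite /M; have := normr_ge0 (y2 - y1); have := normr_ge0 (x3 - x2).
  have := normr_ge0 (y3 - y2); have := normr_ge0 (x2 - x1); lra.
have nD : 0 < `|D| by rewrite normr_gt0.
(* The bend moves by at most [t * M] when all differences move by at most [t], and
   [t * (M + 1) <= |D|] keeps this below [|D|]. *)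
set t := Num.min 1 (`|D| / (M + 1)).
have t1 : t <= 1 by rewrite ge_min lexx.
have t0 : 0 < t by rewrite lt_min ltr01 divr_gt0//; lra.
have tM : t * (M + 1) <= `|D| by rewrite -ler_pdivlMr ?ge_min ?lexx ?orbT//; lra.
exists (t / 2); first by rewrite divr_gt0.
move=> x1' x2' x3' y1' y2' y3' hx1 hx2 hx3 hy1 hy2 hy3; apply/eqP => D'0.
have diff (p p' q q' : R) : `|p' - p| <= t / 2 -> `|q' - q| <= t / 2 ->
    `|(p' - q') - (p - q)| <= t.
  move=> hp hq; rewrite (_ : _ - _ = (p' - p) - (q' - q)); last by ring.
  by have := ler_normB (p' - p) (q' - q); lra.
have A := mul_perturb (diff _ _ _ _ hy2 hy1) (diff _ _ _ _ hx3 hx2) t1.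
have B := mul_perturb (diff _ _ _ _ hy3 hy2) (diff _ _ _ _ hx2 hx1) t1.
have : `|D| <= t * M.
  rewrite -normrN (_ : - D = ((y2' - y1') * (x3' - x2') - (y2 - y1) * (x3 - x2)) -
    ((y3' - y2') * (x2' - x1') - (y3 - y2) * (x2 - x1))); last first.
    by rewrite -[LHS]add0r -D'0 /D /bend; ring.
  have := ler_normB ((y2' - y1') * (x3' - x2') - (y2 - y1) * (x3 - x2))
    ((y3' - y2') * (x2' - x1') - (y3 - y2) * (x2 - x1)).
  by move=> /le_trans; apply; rewrite /M [leRHS]mulrDr; exact: lerD.
by move: tM; rewrite mulrDr mulr1; lra.
Qed.

(** * Gain in mean squared error from one triple *)

Variables (Y : T -> R) (f : R -> R).
Hypothesis iY : rint Y.
Hypothesis cf : continuous f.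
Hypothesis CE : forall B, measurable B ->
  \int[P]_(w in X @^-1` B) (Y w - f (X w)) = 0.

Definition mse (g : R -> R) := \int[P]_w (g (X w) - Y w) ^+ 2.

(** [Y - f(X)] is orthogonal to measurable functions of [X] with values in [[0, 1]]; the bound
    [e <= 1] keeps the hat among them. *)
Lemma expectation_hatY s e : 0 < e <= 1 ->
  \int[P]_w (hat s e (X w) * Y w) = \int[P]_w (hat s e (X w) * f (X w)).
Proof.
move=> /andP[e0 e1].
have ch : continuous (hat s e) by exact: kinks_continuous.
have ifX : rint (fun w => f (X w)) by exact: rint_continuous.
have iYf : rint (fun w => Y w - f (X w)).
  have := rintD iY (rintZ (-1) ifX); apply: eq_integrable => // w _ /=.
  by rewrite mulN1r.
have h0 : \int[P]_w (hat s e (X w) * (Y w - f (X w))) = 0.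
  apply: expectation_mul_eq0 => //; first exact: continuous_measurable_fun.
  by move=> x; have := hat_bound s x e0; lra.
apply/eqP; rewrite -subr_eq0 -mulN1r -RintegralTZ//; last exact: rint_continuousM.
rewrite -RintegralTD ?rintZ//; try exact: rint_continuousM.
apply/eqP; rewrite -[RHS]h0; apply: eq_Rintegral => w _; ring.
Qed.

Lemma continuous_epsilon (x eta : R) : 0 < eta ->
  exists2 e, 0 < e & forall y, `|y - x| < e -> `|f y - f x| <= eta.
Proof.
move=> eta0; have := @cf x.
move=> /cvgrPdist_le/(_ _ eta0)/nbhs_ballP[e /= e0 eP].
by exists e => // y yx; rewrite distrC; apply: eP; rewrite /ball/= distrC.
Qed.

Lemma Rintegral_lin3 c1 c2 c3 u1 u2 u3 : rint u1 -> rint u2 -> rint u3 ->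
  \int[P]_w (c1 * u1 w + c2 * u2 w + c3 * u3 w) =
  c1 * \int[P]_w u1 w + c2 * \int[P]_w u2 w + c3 * \int[P]_w u3 w.
Proof.
by move=> i1 i2 i3; rewrite !RintegralTD ?RintegralTZ//; try apply: rintD; exact: rintZ.
Qed.

Lemma kinks_scale (v : R) (s : seq (R * R)) (x : R) : kinks [seq (v * k.1, k.2) | k <- s] x = v * kinks s x.
Proof.
by rewrite /kinks big_map mulr_sumr; apply: eq_bigr => k _; rewrite mulrA.
Qed.

Lemma kinks_cat (s1 s2 : seq (R * R)) (x : R) : kinks (s1 ++ s2) x = kinks s1 x + kinks s2 x :> R.
Proof. by rewrite /kinks big_cat. Qed.

(* A combination [phi] of three narrow hats, orthogonal to [1] and [x] but not to
   [f]: the coefficients are the cofactors of the matrix of the averages. *)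
Lemma bend_test l r s1 s2 s3 :
  law_support s1 -> law_support s2 -> law_support s3 ->
  l < s1 -> s1 < s2 -> s2 < s3 -> s3 < r -> ~ collinear f s1 s2 s3 ->
  exists s : seq (R * R), [/\ size s = 9%N,
    forall x, ~~ (l < x < r) -> kinks s x = 0,
    \int[P]_w kinks s (X w) = 0, \int[P]_w (kinks s (X w) * X w) = 0 &
    \int[P]_w (kinks s (X w) * Y w) != 0].
Proof.
move=> S1 S2 S3 ls1 s12 s23 s3r nc.
have : bend s1 s2 s3 (f s1) (f s2) (f s3) != 0 by rewrite subr_eq0; apply/eqP.
move=> /bend_perturb[eta eta0 HD].
have [e1 e10 H1] := continuous_epsilon s1 eta0.
have [e2 e20 H2] := continuous_epsilon s2 eta0.
have [e3 e30 H3] := continuous_epsilon s3 eta0.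
(* [e] is small enough for the continuity of [f] at the three points, for averages of [X] to stay
   within [eta] of the centres, and for the hats to be at most [1] and vanish outside []l, r[]. *)
pose e := Num.min (Num.min (Num.min e1 e2) (Num.min e3 eta))
   (Num.min 1 (Num.min (s1 - l) (r - s3))).
have [[ee1 ee2 ee3] [eeta el er] e01] : [/\ [/\ e <= e1, e <= e2 & e <= e3],
    [/\ e <= eta, e <= s1 - l & e <= r - s3] & 0 < e <= 1].
  split; [split|split|]; rewrite /e ?ge_min ?lt_min ?lexx ?orbT//.
  by rewrite e10 e20 e30 eta0 !subr_gt0 ls1 s3r ltr01.
have /andP[e0 e1'] := e01.
have ch s : continuous (hat s e) by exact: kinks_continuous.
have cid : continuous (fun x : R => x) by move=> x; exact: cvg_id.
have ih s : rint (fun w => hat s e (X w)) by exact: rint_continuous.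
have iX : rint X by exact: (@rint_continuous (fun x => x)).
have ihX s : rint (fun w => hat s e (X w) * X w) by exact: rint_continuousM.
have ihY s : rint (fun w => hat s e (X w) * Y w) by exact: rint_continuousM.
have ihf s : rint (fun w => hat s e (X w) * f (X w)).
  by apply: rint_continuousM => //; exact: rint_continuous.
pose m s := \int[P]_w hat s e (X w).
pose x_ s := (\int[P]_w (hat s e (X w) * X w)) / m s.
pose y_ s := (\int[P]_w (hat s e (X w) * Y w)) / m s.
have Hx s : law_support s -> `|x_ s - s| <= eta.
  by move=> Ss; apply: hat_average => // w /ltW/le_trans; exact.
have Hy s e' : law_support s -> e <= e' ->
   (forall y, `|y - s| < e' -> `|f y - f s| <= eta) -> `|y_ s - f s| <= eta.
  move=> Ss ee' H; rewrite /y_ expectation_hatY//; apply: hat_average => // w h.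
  by apply: H; exact: lt_le_trans ee'.
have := HD _ _ _ _ _ _ (Hx _ S1) (Hx _ S2) (Hx _ S3)
   (Hy _ _ S1 ee1 H1) (Hy _ _ S2 ee2 H2) (Hy _ _ S3 ee3 H3).
pose hk (s : R) : seq (R * R) := [:: (1, s - e); (-2, s); (1, s + e)].
move=> nb.
(* Multiplied by the masses [m], the coefficients become differences of the averages [x_]: their sum
   vanishes, so does their sum weighted by [x_], and weighting by [y_] gives minus the bend. *)
have [c1 c1E] : exists c, c = (x_ s3 - x_ s2) / m s1 by eexists.
have [c2 c2E] : exists c, c = (x_ s1 - x_ s3) / m s2 by eexists.
have [c3 c3E] : exists c, c = (x_ s2 - x_ s1) / m s3 by eexists.
have m1 : m s1 != 0 by rewrite gt_eqF// expectation_hat_gt0.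
have m2 : m s2 != 0 by rewrite gt_eqF// expectation_hat_gt0.
have m3 : m s3 != 0 by rewrite gt_eqF// expectation_hat_gt0.
pose sc (v s : R) := [seq (v * k.1, k.2) | k <- hk s].
exists (sc c1 s1 ++ (sc c2 s2 ++ sc c3 s3)).
have kE x : kinks (sc c1 s1 ++ (sc c2 s2 ++ sc c3 s3)) x =
    c1 * hat s1 e x + c2 * hat s2 e x + c3 * hat s3 e x.
  by rewrite !kinks_cat !kinks_scale addrA.
split => //.
- move=> x; rewrite negb_and -!leNgt => xlr; rewrite kE.
  rewrite !hat_eq0 ?mulr0 ?addr0// ler_normr; apply/orP;
    by case/orP: xlr => ?; [right|left]; lra.
- under eq_Rintegral do rewrite kE.
  by rewrite Rintegral_lin3// -/(m s1) -/(m s2) -/(m s3) c1E c2E c3E; field; rewrite m1 m2 m3.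
- under eq_Rintegral do rewrite kE !mulrDl -!mulrA.
  rewrite Rintegral_lin3//.
  have eX s : m s != 0 -> \int[P]_w (hat s e (X w) * X w) = m s * x_ s.
    by move=> ms; rewrite /x_; field.
  by rewrite !eX// c1E c2E c3E; field; rewrite m1 m2 m3.
- under eq_Rintegral do rewrite kE !mulrDl -!mulrA.
  rewrite Rintegral_lin3//.
  have eY s : m s != 0 -> \int[P]_w (hat s e (X w) * Y w) = m s * y_ s.
    by move=> ms; rewrite /y_; field.
  rewrite !eY// (_ : _ + _ = - bend (x_ s1) (x_ s2) (x_ s3) (y_ s1) (y_ s2) (y_ s3)).
    by rewrite oppr_eq0.
  by rewrite /bend c1E c2E c3E; field; rewrite m1 m2 m3.
Qed.

(** The test combination is orthogonal to [N], which is affine wherever the combination is nonzero.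
    The change of the error is then the same quadratic in the scale [t] for all [N], so [gamma] is
    uniform. *)
Lemma bend_gain l r s1 s2 s3 :
  law_support s1 -> law_support s2 -> law_support s3 ->
  l < s1 -> s1 < s2 -> s2 < s3 -> s3 < r -> ~ collinear f s1 s2 s3 ->
  exists s : seq (R * R), size s = 9%N /\ exists2 gamma, 0 < gamma &
    forall N : R -> R, continuous N ->
      (exists al be, forall x, l < x < r -> N x = al + be * x) ->
      rint (fun w => (N (X w) - Y w) ^+ 2) ->
      mse (fun x => N x + kinks s x) <= mse N - gamma.
Proof.
move=> S1 S2 S3 ls1 s12 s23 s3r nc.
have [s0 [sz s0lr E1 EX EY]] := bend_test S1 S2 S3 ls1 s12 s23 s3r nc.
set m := \int[P]_w (kinks s0 (X w) * Y w) in EY.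
have ck : continuous (kinks s0) by exact: kinks_continuous.
have cid : continuous (fun x : R => x) by move=> x; exact: cvg_id.
have ik : rint (fun w => kinks s0 (X w)) by exact: rint_continuous.
have iX : rint X by exact: (@rint_continuous (fun x => x)).
have ikX : rint (fun w => kinks s0 (X w) * X w) by exact: rint_continuousM.
have ikY : rint (fun w => kinks s0 (X w) * Y w) by exact: rint_continuousM.
have ikk : rint (fun w => kinks s0 (X w) * kinks s0 (X w)) by exact: rint_continuousM.
pose A := \int[P]_w (kinks s0 (X w) * kinks s0 (X w)).
have A0 : 0 <= A by apply: Rintegral_ge0 => w _; rewrite -expr2 sqr_ge0.
(* The minimizer would be [m / A]; with [A + 1] the denominator is visibly positive and the
   quadratic is still at most [- m ^ 2 / (A + 1)]. *)
pose t := m / (A + 1).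
exists [seq (t * k.1, k.2) | k <- s0]; rewrite size_map; split => //.
exists (m ^+ 2 / (A + 1)).
  by rewrite divr_gt0 ?exprn_even_gt0//; lra.
move=> N cN [al [be Nlr]] iN.
have kN w : kinks s0 (X w) * N (X w) = kinks s0 (X w) * (al + be * X w).
  have [h|h] := boolP (l < X w < r); first by rewrite Nlr.
  by rewrite s0lr// !mul0r.
have -> : mse (fun x => N x + kinks [seq (t * k.1, k.2) | k <- s0] x) =
  mse N + ((2 * t * al) * \int[P]_w kinks s0 (X w) +
    (2 * t * be) * \int[P]_w (kinks s0 (X w) * X w) + (- (2 * t)) * m) + t ^+ 2 * A.
  have i3 := rintD (rintD (rintZ (2 * t * al) ik) (rintZ (2 * t * be) ikX))
    (rintZ (- (2 * t)) ikY).
  have i4 := rintD iN i3; have i5 := rintZ (t ^+ 2) ikk.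
  rewrite -Rintegral_lin3// -RintegralTD// -RintegralTZ// -RintegralTD//.
  apply: eq_Rintegral => w _; rewrite kinks_scale.
  set k := kinks s0 (X w).
  have -> : (N (X w) + t * k - Y w) ^+ 2 =
    (N (X w) - Y w) ^+ 2 + 2 * t * (k * N (X w) - k * Y w) + t ^+ 2 * (k * k) by ring.
  by rewrite /k kN; ring.
rewrite E1 EX !mulr0 !add0r -subr_ge0.
have -> : mse N - m ^+ 2 / (A + 1) - (mse N + - (2 * t) * m + t ^+ 2 * A) =
   (m / (A + 1)) ^+ 2 by rewrite /t; field; rewrite gt_eqF//; lra.
exact: sqr_ge0.
Qed.

End Averages.

(** * Networks with inert neurons *)

Lemma out_bias_val h : val (out_bias h) = (3 * h)%N.
Proof. by rewrite /out_bias /= inordK. Qed.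

Lemma in_weight_val h (i : 'I_h) : val (in_weight i) = i.
Proof. by rewrite /in_weight /= inordK//; have := ltn_ord i; lia. Qed.

Lemma in_bias_val h (i : 'I_h) : val (in_bias i) = (h + i)%N.
Proof. by rewrite /in_bias /= inordK//; have := ltn_ord i; lia. Qed.

Lemma out_weight_val h (i : 'I_h) : val (out_weight i) = (2 * h + i)%N.
Proof. by rewrite /out_weight /= inordK//; have := ltn_ord i; lia. Qed.

Definition index_valE := (out_bias_val, in_weight_val, in_bias_val, out_weight_val).

Section Networks.
Context {R : realType}.
Variables (sigma : R -> R) (a b : R).
Hypothesis sigmaE : forall x, sigma x = Num.max x 0.

Lemma sigma_continuous : continuous sigma.
Proof.
have -> : sigma = (fun x => Num.max x 0) by apply/funext.
move=> x; apply: (@continuous_max _ _ (fun y : R => y) (fun=> 0)); last exact: cvg_cst.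
exact: cvg_id.
Qed.

Lemma network_continuous h (theta : 'rV[R]_(D h)) : continuous (network sigma theta).
Proof.
move=> x; apply: cvgD; first exact: cvg_cst.
apply: (@cvg_big _ _ +%R 0 xpredT _ _ _ _ (fun (i : 'I_h) (y : R) =>
    theta 0 (out_weight i) * sigma (theta 0 (in_bias i) + theta 0 (in_weight i) * y))
  (fun i => theta 0 (out_weight i) * sigma (theta 0 (in_bias i) + theta 0 (in_weight i) * x))).
  exact: add_continuous.
move=> i _.
apply: cvgM; first exact: cvg_cst.
apply: continuous_comp; last exact: sigma_continuous.
by apply: cvgD; [exact: cvg_cst|apply: cvgM; [exact: cvg_cst|exact: cvg_id]].
Qed.

Lemma neuron_affine v c w l r : ~~ (l < - c / w < r) ->
  exists pq : R * R, forall x, l < x < r -> v * sigma (c + w * x) = pq.1 + pq.2 * x.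
Proof.
(* With [w = 0] the quotient is [0] by convention and marks no breakpoint; the neuron is
   constant. *)
have [->|w0] := eqVneq w 0.
  by exists (v * sigma c, 0) => x _; rewrite !mul0r !addr0.
have cE x : c + w * x = w * (x - - c / w) by field.
set k := - c / w in cE *.
have act : (forall x, l < x < r -> 0 <= w * (x - k)) \/
           (forall x, l < x < r -> w * (x - k) <= 0) ->
    exists pq : R * R, forall x, l < x < r -> v * sigma (c + w * x) = pq.1 + pq.2 * x.
  move=> [H|H].
    exists (v * c, v * w) => x /H; rewrite -cE => ge0.
    by rewrite sigmaE (max_idPl ge0)/=; ring.
  exists (0, 0) => x /H; rewrite -cE => le0.
  by rewrite sigmaE (max_idPr le0)/=; ring.
rewrite negb_and -!leNgt => /orP[kl|rk]; apply: act;
  case/orP: (lt_total w0) => hw; [right|left|left|right] => x xlr; nra.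
Qed.

Lemma network_affine h (theta : 'rV[R]_(D h)) l r :
  (forall i : 'I_h, ~~ (l < - theta 0 (in_bias i) / theta 0 (in_weight i) < r)) ->
  exists al be, forall x, l < x < r -> network sigma theta x = al + be * x.
Proof.
move=> H; have /choice[pq pqE] := fun i => @neuron_affine (theta 0 (out_weight i)) _ _ _ _ (H i).
exists (theta 0 (out_bias h) + \sum_(i < h) (pq i).1), (\sum_(i < h) (pq i).2) => x xlr.
rewrite /network -addrA mulr_suml -big_split/=; congr (_ + _).
by apply: eq_bigr => i _; exact: pqE.
Qed.

(** Covers both neurons whose ReLU vanishes on [[a, b]], as found at initialization, and neurons
    with outer weight zero, from which a network for a spline is built. *)
Definition inert h (theta : 'rV[R]_(D h)) (i : 'I_h) := forall x, a <= x <= b ->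
  theta 0 (out_weight i) *
    sigma (theta 0 (in_bias i) + theta 0 (in_weight i) * x) = 0.

Definition set_neuron h (theta : 'rV[R]_(D h)) (i : 'I_h) (k : R * R) : 'rV[R]_(D h) :=
  \row_j if j == in_weight i then 1 else if j == in_bias i then - k.2
         else if j == out_weight i then k.1 else theta 0 j.

Lemma set_neuronE h (theta : 'rV[R]_(D h)) (i : 'I_h) k :
  [/\ set_neuron theta i k 0 (out_bias h) = theta 0 (out_bias h),
   (set_neuron theta i k 0 (in_weight i) = 1) /\
     (set_neuron theta i k 0 (in_bias i) = - k.2),
   set_neuron theta i k 0 (out_weight i) = k.1 &
   forall j, j != i ->
     [/\ set_neuron theta i k 0 (in_weight j) = theta 0 (in_weight j),
         set_neuron theta i k 0 (in_bias j) = theta 0 (in_bias j) &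
         set_neuron theta i k 0 (out_weight j) = theta 0 (out_weight j)]].
Proof.
have ih := ltn_ord i.
split; [|split| |move=> j ji; split];
  rewrite mxE -!(inj_eq val_inj) !index_valE ?eqxx//.
- by rewrite !ifF//; apply/eqP; lia.
- by rewrite ifF//; apply/eqP; lia.
- by rewrite !ifF//; apply/eqP; lia.
- have jh := ltn_ord j; have {}ji : (j : nat) <> i by move=> /val_inj/eqP; exact/negP.
  by rewrite !ifF//; apply/eqP; lia.
- have jh := ltn_ord j; have {}ji : (j : nat) <> i by move=> /val_inj/eqP; exact/negP.
  by rewrite !ifF//; apply/eqP; lia.
- have jh := ltn_ord j; have {}ji : (j : nat) <> i by move=> /val_inj/eqP; exact/negP.
  by rewrite !ifF//; apply/eqP; lia.
Qed.

(** Each kink overwrites one inert neuron, which contributed nothing on [[a, b]]; the remaining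
    neurons of [A] stay inert. *)
Lemma add_neurons h (s : seq (R * R)) (theta : 'rV[R]_(D h)) (A : {set 'I_h}) :
  (forall i, i \in A -> inert theta i) -> (size s <= #|A|)%N ->
  exists theta' : 'rV[R]_(D h), forall x, a <= x <= b ->
    network sigma theta' x = network sigma theta x + kinks s x.
Proof.
elim: s theta A => [|k s IHs] theta A inA sA.
  by exists theta => x _; rewrite kinks_nil addr0.
have [i iA] : exists i, i \in A by apply/card_gt0P; exact: leq_trans sA.
have [e1 [e2 e3] e4 e5] := set_neuronE theta i k.
have [||theta' H] := IHs (set_neuron theta i k) (A :\ i).
- move=> j; rewrite !inE => /andP[ji jA].
  have [f1 f2 f3] := e5 _ ji.
  by move=> x /(inA _ jA); rewrite f1 f2 f3.
- by move: sA; rewrite (cardsD1 i) iA.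
exists theta' => x xab; rewrite H// kinks_cons addrA; congr (_ + _).
rewrite /network e1 -addrA; congr (_ + _).
rewrite (bigD1 i)//= [in RHS](bigD1 i)//=.
have i0 := inA _ iA x xab; rewrite i0 add0r addrC; congr (_ + _).
  by apply: eq_bigr => j ji; have [-> -> ->] := e5 _ ji.
by rewrite e2 e3 e4 sigmaE mul1r; congr (_ * Num.max _ _); exact: addrC.
Qed.

Lemma spline_network p : spline p -> exists h (theta : 'rV[R]_(D h)),
  (0 < h)%N /\ forall x, a <= x <= b -> network sigma theta x = p x.
Proof.
(* The extra neuron keeps the width positive even if [s] is empty. *)
move=> [c [s ->]]; pose h := (size s).+1.
pose theta : 'rV[R]_(D h) := \row_j if j == out_bias h then c else 0.
have out0 (i : 'I_h) : theta 0 (out_weight i) = 0.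
  rewrite mxE -(inj_eq val_inj) !index_valE ifF//.
  by apply/eqP; have := ltn_ord i; lia.
have [||theta' H] := @add_neurons h s theta [set: 'I_h].
- by move=> i _ x _; rewrite out0 mul0r.
- by rewrite cardsT card_ord.
exists h, theta'; split => // x xab; rewrite H//; congr (_ + _).
rewrite /network mxE eqxx big1 ?addr0// => i _.
by rewrite out0 mul0r.
Qed.

End Networks.

(** * Uniform risk reduction from nine inert neurons *)

Section Improvement.
Context {R : realType} {d : measure_display} {T : measurableType d}.
Variables (P : probability T R) (X Y : T -> R) (a b : R) (f : R -> R).
Hypothesis mX : measurable_fun setT X.
Hypothesis Xab : forall w, a <= X w <= b.
Hypothesis iY : P.-integrable setT (EFin \o Y).
Hypothesis cf : continuous f.
Hypothesis CE : forall B, measurable B ->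
  \int[P]_(w in X @^-1` B) (Y w - f (X w)) = 0.

Local Notation S := (law_support P X).

Lemma measurable_preimage_itvoo l r : measurable (X @^-1` `]l, r[).
Proof. by rewrite -[X in measurable X]setTI; apply: mX. Qed.

Lemma law_support_closed : closed S.
Proof.
move=> x clx e e0 ; have [s [Ss xs]] := clx _ (nbhsx_ballx x (e / 2) ltac:(by rewrite divr_gt0)).
move: xs; rewrite /ball/= ltr_distlC => /andP[xs1 xs2].
apply: contra (Ss (e / 2) ltac:(by rewrite divr_gt0)) => /eqP P0.
apply/eqP/(subset_measure0 _ _ _ P0) => //; try exact: measurable_preimage_itvoo.
by move=> w /=; rewrite !in_itv/= => /andP[? ?]; apply/andP; lra.
Qed.

(** A value outside the support lies in a null interval with rational endpoints, and there are only
    countably many of these. *)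
Lemma ae_law_support : {ae P, forall w, S (X w)}.
Proof.
pose F (n : nat) : set T := match unpickle n : option (rat * rat) with
  | Some pq => if P (X @^-1` `]ratr pq.1, ratr pq.2[) == 0%E
               then X @^-1` `]ratr pq.1, ratr pq.2[ else set0
  | None => set0 end.
have NF n : P.-negligible (F n).
  rewrite /F; case: unpickle => [pq|]; last exact: negligible_set0.
  case: ifPn => [/eqP P0|_]; last exact: negligible_set0.
  by apply/negligibleP => //; exact: measurable_preimage_itvoo.
apply: negligibleS (negligible_bigcup NF) => w /= nS.
have [e [e0 Pe]] : exists e, 0 < e /\ P (X @^-1` `]X w - e, X w + e[) = 0%E.
  apply: contrapT => H; apply: nS => e e0; apply/eqP => Pe.
  by apply: H; exists e.
have [p] := @rat_in_itvoo R (X w - e) (X w) ltac:(by rewrite ltrBlDr ltrDl).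
rewrite in_itv => /andP[p1 p2].
have [q] := @rat_in_itvoo R (X w) (X w + e) ltac:(by rewrite ltrDl).
rewrite in_itv => /andP[q1 q2].
have Ppq : P (X @^-1` `]ratr p, ratr q[) = 0%E.
  apply: (subset_measure0 _ _ _ Pe); try exact: measurable_preimage_itvoo.
  move=> v; rewrite /preimage /mkset !in_itv => /andP[v1 v2].
  by apply/andP; split; [exact: lt_trans v1|exact: lt_trans v2 _].
exists (pickle (p, q)); first exact: I.
rewrite /F pickleK; cbv beta iota delta [fst snd]; rewrite Ppq eqxx.
by rewrite /preimage /mkset in_itv; apply/andP.
Qed.

(* Pigeonhole: fewer than [n] breakpoints leave one of the [n] disjoint intervals
   spanned by the triples of the chain free of breakpoints. *)
Lemma chain_gain n u : chain f S u n -> exists2 eps, 0 < eps &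
  forall (bs : seq R) (N : R -> R), continuous N ->
    (forall l r, ~~ has (fun c => l < c < r) bs ->
       exists al be, forall x, l < x < r -> N x = al + be * x) ->
    P.-integrable setT (EFin \o (fun w => (N (X w) - Y w) ^+ 2)) ->
    (count (fun c => u < c)%R bs < n)%N ->
    exists2 s : seq (R * R), size s = 9%N &
      mse P X Y (fun x => N x + kinks s x) <= mse P X Y N - eps.
Proof.
elim: n u => [u _|n IHn u /= [s1 [s2 [s3 [[S1 S2 S3] us1 s12 s23 [nc ch]]]]]].
  (* For [n = 0] no count is below [n], so every positive [eps] will do. *)
  by exists 1.
have [x s3x chx] := chain_gt ch.
have [s [sz [g g0 G]]] := bend_gain mX Xab iY cf CE S1 S2 S3 us1 s12 s23 s3x nc.
have [e e0 E] := IHn x chx.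
exists (Num.min g e); first by rewrite lt_min g0.
move=> bs N cN aN iN cnt.
(* Without a breakpoint in []u, x[] the first triple gives the gain. Otherwise fewer breakpoints lie
   beyond [x], and the rest of the chain applies. *)
have [hb|hb] := boolP (has (fun c => u < c < x) bs); last first.
  exists s => //; apply: (le_trans (G N cN (aN _ _ hb) iN)).
  by rewrite lerD2l lerN2 ge_min lexx.
have [s' sz' H] : exists2 s : seq (R * R), size s = 9%N &
      mse P X Y (fun x => N x + kinks s x) <= mse P X Y N - e.
  apply: (E bs) => //; move: hb; rewrite has_count => hb.
  suff : (count (fun c => x < c)%R bs + count (fun c => u < c < x)%R bs
      <= count (fun c => u < c)%R bs)%N.
    move=> le3; rewrite -ltnS; apply: leq_trans cnt; rewrite ltnS.
    by apply: leq_trans le3; rewrite -addn1 leq_add2l.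
  elim: bs {cnt hb aN} => [|c bs IH] //=.
  have ux : u < x by lra.
  move: IH; move: (count _ bs) (count _ bs) (count _ bs) => A B C IH.
  case: (ltgtP x c) => xc; case: (ltP u c) => uc /=; try lia.
  by exfalso; lra.
exists s' => //; apply: (le_trans H).
by rewrite lerD2l lerN2 ge_min lexx orbT.
Qed.

Variable sigma : R -> R.
Hypothesis sigmaE : forall x, sigma x = Num.max x 0.
Hypothesis not_network : forall h (theta : 'rV[R]_(D h)), (0 < h)%N ->
  ~ {ae P, forall w, network sigma theta (X w) = f (X w)}.

(** [eps] comes from a chain of [h + 1] triples, fixed before [theta]. The at most [h] breakpoints
    of the network miss the interval around one triple, and the nine kinks of its test combination
    fit into the inert neurons. *)
Lemma inert_improvement h : exists2 eps, 0 < eps &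
  forall (theta : 'rV[R]_(D h)) (A : {set 'I_h}),
    P.-integrable setT (EFin \o (fun w => (network sigma theta (X w) - Y w) ^+ 2)) ->
    (forall i, i \in A -> inert sigma a b theta i) -> (9 <= #|A|)%N ->
    exists theta' : 'rV[R]_(D h),
      mse P X Y (network sigma theta') <= mse P X Y (network sigma theta) - eps.
Proof.
(* All values of [X] exceed [a - 1], so a spline equal to [f] on the support beyond [a - 1] would
   contradict [not_network]. *)
have ch : chain f S (a - 1) h.+1.
  apply: chain_exists => //; first exact: law_support_closed.
  move=> [p sp pf]; have [k [theta [k0 H]]] := spline_network a b sigmaE sp.
  apply: (not_network k0 (theta := theta)).
  have := ae_law_support; apply: filterS => w Sw.
  rewrite H//; apply: pf => //; have /andP[? _] := Xab w; lra.
have [eps eps0 E] := chain_gain ch.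
exists eps => // theta A iN inA cA.
pose bs := [seq - theta 0 (in_bias i) / theta 0 (in_weight i) | i <- enum 'I_h].
have [||s sz H] := E bs _ (@network_continuous _ _ sigmaE _ theta) _ iN.
- move=> l r /hasPn hb; apply: network_affine => // i.
  by apply: hb; apply/mapP; exists i; rewrite ?mem_enum.
- by rewrite ltnS (leq_trans (count_size _ _))// size_map size_enum_ord.
have [theta' H'] := @add_neurons _ _ _ _ sigmaE _ s _ _ inA ltac:(by rewrite sz).
exists theta'; apply: le_trans H; rewrite le_eqVlt; apply/orP; left; apply/eqP.
by apply: eq_Rintegral => w _; rewrite H'.
Qed.

End Improvement.

(** * Independent events in blocks *)

Section Blocks.
Context {R : realType} {d : measure_display} {T : measurableType d}.
Variables (P : probability T R) (h : nat) (E : 'I_h -> set T) (p : R).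
Hypothesis mE : forall i, measurable (E i).
Hypothesis PE : forall J : {set 'I_h}, P (\bigcap_(i in [set` J]) E i) = (p ^+ #|J|)%:E.

Definition pattern (J : {set 'I_h}) (s : seq 'I_h) : set T :=
  [set w | (forall i, i \in J -> E i w) /\ (forall i, i \in s -> ~ E i w)].

(** Induction on [s]: requiring that [E i] fails removes the pattern in which [E i] occurs, which
    multiplies the probability by [1 - p]. *)
Lemma pattern_probability (J : {set 'I_h}) (s : seq 'I_h) : uniq s -> (forall i, i \in s -> i \notin J) ->
  measurable (pattern J s) /\ P (pattern J s) = ((1 - p) ^+ size s * p ^+ #|J|)%:E.
Proof.
elim: s J => [|i s IHs] J /=.
  have -> : pattern J [::] = \bigcap_(i in [set` J]) E i.
    by apply/seteqP; split => w /=; [case=> H _ i /= /H|move=> H; split].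
  by rewrite PE expr0 mul1r; split => //; exact: fin_bigcap_measurable.
move=> /andP[is_ us] sJ.
have iJ : i \notin J by apply: sJ; rewrite mem_head.
have [|m1 P1] := IHs J us; first by move=> j js; apply: sJ; rewrite in_cons js orbT.
have [|m2 P2] := IHs (i |: J)%SET us.
  move=> j js; rewrite !inE negb_or sJ ?in_cons ?js ?orbT// andbT.
  by apply: contraNneq is_ => <-.
have -> : pattern J (i :: s) = pattern J s `\` pattern (i |: J)%SET s.
  apply/seteqP; split => w /=.
    move=> [HJ Hs]; split.
      by split => // j js; apply: Hs; rewrite in_cons js orbT.
    by move=> [H _]; apply: (Hs i); rewrite ?mem_head//; apply: H; rewrite !inE eqxx.
  move=> [[HJ Hs] H]; split => // j; rewrite in_cons => /predU1P[->|]; last exact: Hs.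
  move=> Ei; apply: H; split => // k; rewrite !inE => /predU1P[->//|]; exact: HJ.
split; first exact: measurableD.
have fin : (P (pattern J s) < +oo)%E by rewrite P1 ltry.
have sub : pattern (i |: J)%SET s `<=` pattern J s.
  by move=> w [HJ Hs]; split => // j jJ; apply: HJ; rewrite !inE jJ orbT.
have : (P (pattern J s) - P (pattern (i |: J)%SET s) =
    ((1 - p) ^+ (size s).+1 * p ^+ #|J|)%:E)%E.
  by rewrite P1 P2 -EFinB; congr EFin; rewrite cardsU1 iJ add1n !exprS; ring.
by move=> <-; have := measureD m1 m2 fin; rewrite (setIidr sub).
Qed.

Lemma event_probability_le1 : (0 < h)%N -> p <= 1.
Proof.
move=> h0; have := PE [set Ordinal h0]%SET; rewrite cards1 expr1 => e.
by rewrite -lee_fin -e probability_le1//; exact: fin_bigcap_measurable.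
Qed.

Let m := (h %/ 9)%N.

Fact block_subproof (k : 'I_9) (j : 'I_m) : (k * m + j < h)%N.
Proof. by have := ltn_ord k; have := ltn_ord j; rewrite /m; nia. Qed.

Definition block k : seq 'I_h := [seq Ordinal (block_subproof k j) | j <- enum 'I_m].

(* If fewer than nine of the events occur, then none occurs in one of nine blocks
   of [h / 9] events. *)
Lemma few_events : exists2 C : set T, measurable C &
  (P C <= (9 * (1 - p) ^+ (h %/ 9))%:E)%E /\
  forall w, ~ C w -> (9 <= #|[set i | `[< E i w >]]%SET|)%N.
Proof.
have ub k : uniq (block k).
  rewrite map_inj_uniq ?enum_uniq// => j j' [] /eqP; rewrite eqn_add2l => /eqP e.
  exact: val_inj.
have mPk k := @pattern_probability finset.set0 _ (ub k) (fun i _ => ltac:(by rewrite inE)).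
pose C := \big[setU/set0]_(k < 9) pattern finset.set0 (block k).
have mC : measurable C by apply: bigsetU_measurable => k _; exact: (mPk k).1.
exists C => //; split.
  pose A_ (k : nat) := if insub k is Some i then pattern finset.set0 (block i) else set0.
  have := @content_subadditive _ _ _ P C A_ 9%N.
  have A_E (k : 'I_9) : A_ k = pattern finset.set0 (block k) by rewrite /A_ valK.
  move=> /(_ _ mC); have mA : forall k, `I_9 k -> measurable (A_ k).
    by move=> k /= k9; rewrite (A_E (Ordinal k9)); exact: (mPk _).1.
  move=> /(_ mA) H; apply: le_trans (H _) _.
    by rewrite /C; under eq_bigr do rewrite -A_E.
  rewrite (eq_bigr (fun=> ((1 - p) ^+ m)%:E)).
    by rewrite sumEFin sumr_const card_ord lee_fin mulr_natl.
  move=> k _; rewrite A_E; apply: (etrans (mPk k).2).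
  by rewrite cards0 expr0 mulr1 size_map size_enum_ord.
move=> w nC; have /choice[g gE] : forall k : 'I_9, exists i, i \in block k /\ E i w.
  move=> k; apply: contrapT => H; apply: nC; rewrite /C -bigcup_seq.
  exists k => /=; first by rewrite mem_index_enum.
  by split => i; rewrite ?inE// => ib Ei; apply: H; exists i.
(* The blocks are disjoint, so witnesses from different blocks differ. *)
have ginj : injective g.
  move=> k k' gg; apply: val_inj.
  have [/mapP[j _ e] _] := gE k; have [/mapP[j' _ e'] _] := gE k'.
  have := congr1 val (etrans (esym e) (etrans gg e')) => /=.
  by have := ltn_ord j; have := ltn_ord j'; nia.
rewrite -[X in (X <= _)%N](card_ord 9) -(card_imset _ ginj).
by apply: subset_leq_card; apply/fintype.subsetP => _ /imsetP[k _ ->]; rewrite inE; apply/asboolP; exact: (gE k).2.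
Qed.

End Blocks.

(** From [1 - p <= exp(-p)] and [h <= 9 * (h %/ 9) + 9], the power is at most [e * exp(- delta * h)]
    as soon as [delta <= p / 9]. The other bound on [delta] lets its inverse absorb [9 * e]. *)
Lemma geometric_le_exp {R : realType} (p : R) : 0 < p -> p <= 1 ->
  exists2 delta, 0 < delta &
    forall h, 9 * (1 - p) ^+ (h %/ 9) <= delta^-1 * expR (- delta * h%:R).
Proof.
move=> p0 p1; exists (Num.min (p / 9) (9 * expR 1)^-1).
  by rewrite lt_min divr_gt0//= invr_gt0 mulr_gt0 ?expR_gt0.
set del := Num.min _ _ => h.
have del0 : 0 < del by rewrite lt_min divr_gt0//= invr_gt0 mulr_gt0 ?expR_gt0.
have d1 : del <= p / 9 by rewrite ge_min lexx.
have d2 : 9 * expR 1 <= del^-1.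
  rewrite -[leLHS]invrK lef_pV2 ?posrE ?invr_gt0 ?mulr_gt0 ?expR_gt0//.
  by rewrite ge_min lexx orbT.
have le1 : (1 - p) ^+ (h %/ 9) <= expR (- p * (h %/ 9)%:R).
  rewrite expRM_natr lerXn2r ?nnegrE ?expR_ge0//; first by lra.
  exact: expR_ge1Dx.
have hm : h%:R <= 9 * (h %/ 9)%:R + 9 :> R.
  have : (h <= 9 * (h %/ 9) + 9)%N by lia.
  by rewrite -(ler_nat R) natrD natrM.
have le2 : expR (- p * (h %/ 9)%:R) <= expR 1 * expR (- del * h%:R).
  rewrite -expRD ler_expR.
  have h0 : 0 <= h%:R :> R by [].
  have : del * h%:R <= p / 9 * h%:R by rewrite ler_wpM2r.
  have : p * h%:R <= p * (9 * (h %/ 9)%:R + 9) by rewrite ler_wpM2l// ltW.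
  by rewrite mulrDr; lra.
apply: (@le_trans _ _ (9 * (expR 1 * expR (- del * h%:R)))).
  by rewrite ler_wpM2l// (le_trans le1).
by rewrite mulrA ler_wpM2r// expR_ge0.
Qed.

(** A zero integral would force [q = 0] almost everywhere on [D], a set of nonzero measure. *)
Lemma integral_pos {R : realType} (q : R -> R) (D : set R) :
  (forall x, 0 <= q x) -> measurable_fun setT q -> measurable D ->
  lebesgue_measure D != 0%E -> (forall x, D x -> 0 < q x) ->
  (0 < \int[lebesgue_measure]_(x in D) (q x)%:E)%E.
Proof.
move=> q0 mq mD D0 qD; rewrite lt0e; apply/andP; split; last first.
  by apply: integral_ge0 => x _; rewrite lee_fin.
apply/eqP => I0.
have : ae_eq lebesgue_measure D (EFin \o q) (cst 0%E).
  apply/ae_eq_integral_abs => //.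
    by apply/measurable_EFinP; exact: measurable_funTS.
  by rewrite -I0; apply: eq_integral => x _ /=; rewrite ger0_norm.
move=> [N [mN N0 DN]]; move/eqP: D0; apply.
apply: (subset_measure0 _ _ _ N0) => // x Dx; apply: DN => /= /(_ Dx) [] q0x.
by have := qD x Dx; rewrite q0x ltxx.
Qed.

(** * Dead neurons at initialization *)

(** The preactivation is affine in [x], so the endpoints control all of [[a, b]]; strict signs make
    the condition open in [theta]. *)
Definition dead {R : realType} (a b : R) h (theta : 'rV[R]_(D h)) (i : 'I_h) : Prop :=
  theta 0 (in_bias i) + theta 0 (in_weight i) * a < 0 /\
  theta 0 (in_bias i) + theta 0 (in_weight i) * b < 0.

Section Initialization.
Context {R : realType} {d : measure_display} {T : measurableType d}.
Variables (P : probability T R) (Theta : forall h, T -> 'rV[R]_(D h)).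
Hypothesis mTheta : forall h j, measurable_fun setT (fun w => Theta h w 0 j).
Hypothesis Theta_indep : forall h, (0 < h)%N ->
  independent_family P (fun (i : 'I_(2 * h)) w => Theta h w 0 (inner_param i)).
Variables (q : R -> R) (eta kappa a b : R).
Hypothesis q_ge0 : forall x, 0 <= q x.
Hypothesis q_meas : measurable_fun setT q.
Hypothesis eta_gt0 : 0 < eta.
Hypothesis q_pos : `]- eta, eta[ `<=` q @^-1` `]0, +oo[.
Hypothesis Theta_density : forall h, (0 < h)%N -> forall (i : 'I_(2 * h)) (x : R),
     P [set w | h%:R `^ kappa * Theta h w 0 (inner_param i) < x] =
     (\int[lebesgue_measure]_(y in `]-oo, x[) (q y)%:E)%E.

(** The thresholds are set so that a scaled weight of modulus at most [c1] and a scaled bias below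
    [- eta / 2] make a neuron dead; [pW] and [pB] are the probabilities attached to them. *)
Let c1 := eta / (2 * (Num.max `|a| `|b| + 1)).
Let F (x : R) := (\int[lebesgue_measure]_(y in `]-oo, x[) (q y)%:E)%E.
Let pW := fine (\int[lebesgue_measure]_(y in `[(- c1)%R, c1[) (q y)%:E)%E.
Let pB := fine (F (- (eta / 2))).

Let mq (A : set R) : measurable_fun A (EFin \o q).
Proof. by apply/measurable_EFinP; exact: measurable_funTS. Qed.

Let one_j : 'I_(2 * 1) := ord0.

(** At width [1] the values of [F] are probabilities. *)
Let F_fin x : F x \is a fin_num.
Proof.
rewrite /F -(Theta_density (ltn0Sn 0) one_j) fin_num_measure//.
rewrite -[X in measurable X]setTI.
rewrite (_ : [set w | _] = (fun w => 1%:R `^ kappa * Theta 1 w 0 (inner_param one_j)) @^-1` `]-oo, x[).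
  by apply: measurable_funM => //; exact: measurable_cst.
by apply/seteqP; split => w /=; rewrite in_itv.
Qed.

Let M := Num.max `|a| `|b| + 1.

Let M_gt0 : 0 < M.
Proof. by rewrite /M ltr_wpDl// le_max normr_ge0. Qed.

Let c1M : c1 * M = eta / 2.
Proof. by rewrite /c1 -/M; field; rewrite gt_eqF. Qed.

Let c1_gt0 : 0 < c1.
Proof. by rewrite divr_gt0// mulr_gt0. Qed.

Let c1_lt : c1 < eta.
Proof.
have M1 : 1 <= M by rewrite /M lerDr le_max normr_ge0.
have : c1 <= c1 * M by rewrite ler_peMr// ltW.
rewrite c1M => /le_lt_trans; apply.
by have := eta_gt0; lra.
Qed.

Let F_split : F c1 = (F (- c1)%R + \int[lebesgue_measure]_(y in `[(- c1)%R, c1[) (q y)%:E)%E.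
Proof.
rewrite /F; have -> : `]-oo, c1[%classic = `]-oo, - c1[ `|` `[- c1, c1[ :> set R.
  apply/seteqP; split => x /=; rewrite !in_itv/=.
    by case: (ltP x (- c1)) => /=; [left|right].
  by case=> [h|/andP[_ ->//]]; apply: (lt_trans h); rewrite gtrN.
rewrite ge0_integral_setU//.
- exact: mq.
- by move=> x _; rewrite lee_fin.
- apply/disj_setPS => x [] /=; rewrite !in_itv/= => h /andP[h' _].
  by move: h; rewrite ltNge h'.
Qed.

Let pWE : (\int[lebesgue_measure]_(y in `[(- c1)%R, c1[) (q y)%:E = pW%:E)%E.
Proof.
rewrite fineK//; have := F_fin c1; rewrite F_split fin_numD.
by case/andP.
Qed.

Let pW_gt0 : 0 < pW.
Proof.
rewrite -lte_fin -pWE; apply: integral_pos => //.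
  rewrite lebesgue_measure_itv/= lte_fin gtrN// -EFinD eqe.
  by rewrite opprK gt_eqF// addr_gt0.
move=> x /=; rewrite in_itv/= => /andP[x1 x2].
have : `]- eta, eta[%classic x.
  by rewrite /= in_itv/= (lt_le_trans _ x1) ?ltrN2// (lt_trans x2).
by move=> /q_pos/=; rewrite in_itv/= andbT.
Qed.

Let pB_gt0 : 0 < pB.
Proof.
have e2 : - eta < - (eta / 2) by rewrite ltrN2 gtr_pMr// invf_lt1// ltr1n.
have e20 : 0 < eta / 2 by rewrite divr_gt0.
rewrite -lte_fin /pB fineK//.
apply: (@lt_le_trans _ _ (\int[lebesgue_measure]_(y in `](- eta)%R, (- (eta / 2))%R[) (q y)%:E)%E).
  apply: integral_pos => //.
    rewrite lebesgue_measure_itv/= lte_fin e2.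
    by rewrite -EFinD eqe gt_eqF// subr_gt0.
  move=> x /=; rewrite in_itv/= => /andP[x1 x2].
  have : `]- eta, eta[%classic x.
    by rewrite /= in_itv/= x1 (lt_trans x2)// (lt_trans (y := 0)) ?oppr_lt0.
  by move=> /q_pos/=; rewrite in_itv/= andbT.
apply: ge0_subset_integral => //.
- exact: mq.
- by move=> x _; rewrite lee_fin.
- by move=> x /=; rewrite !in_itv/= => /andP[].
Qed.

Section Width.
Variable h : nat.
Hypothesis h_gt0 : (0 < h)%N.

Let c := h%:R `^ kappa.

Let c_gt0 : 0 < c.
Proof. by rewrite powR_gt0// ltr0n. Qed.

Fact weight_subproof (i : 'I_h) : (i < 2 * h)%N.
Proof. by rewrite (leq_trans (ltn_ord i))// leq_pmull. Qed.

Fact bias_subproof (i : 'I_h) : (h + i < 2 * h)%N.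
Proof. by rewrite mul2n -addnn ltn_add2l. Qed.

Let wi (i : 'I_h) := Ordinal (weight_subproof i).
Let bi (i : 'I_h) := Ordinal (bias_subproof i).

Let wiE i : inner_param (wi i) = in_weight i.
Proof. by []. Qed.

Let biE i : inner_param (bi i) = in_bias i.
Proof. by []. Qed.

Let AW := [set y : R | - c1 <= c * y < c1].
Let AB := [set y : R | c * y < - (eta / 2)].

Let mscale : measurable_fun setT (fun y : R => c * y).
Proof. exact: mulrl_measurable. Qed.

Let mAW : measurable AW.
Proof.
rewrite -[AW]setTI (_ : AW = (fun y => c * y) @^-1` `[- c1, c1[); first exact: mscale.
by apply/seteqP; split => w /=; rewrite in_itv.
Qed.

Let mAB : measurable AB.
Proof.
rewrite -[AB]setTI (_ : AB = (fun y => c * y) @^-1` `]-oo, - (eta / 2)[); first exact: mscale.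
by apply/seteqP; split => w /=; rewrite in_itv.
Qed.

Let Z (j : 'I_(2 * h)) w := Theta h w 0 (inner_param j).

Let mZ j A : measurable A -> measurable (Z j @^-1` A).
Proof. by move=> mA; rewrite -[X in measurable X]setTI; apply: mTheta. Qed.

Let PAB j : P (Z j @^-1` AB) = pB%:E.
Proof. by rewrite /pB fineK//; exact: (Theta_density h_gt0 j). Qed.

(** Only the probabilities of half-lines are given, so that of the half-open interval is obtained as
    a difference of finite terms. *)
Let PAW j : P (Z j @^-1` AW) = pW%:E.
Proof.
have mlt x : measurable [set w | c * Z j w < x].
  rewrite (_ : [set w | _] = Z j @^-1` ((fun y => c * y) @^-1` `]-oo, x[)).
    by apply: mZ; rewrite -[X in measurable X]setTI; exact: mscale.
  by apply/seteqP; split => w /=; rewrite in_itv.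
have E : [set w | c * Z j w < c1] = [set w | c * Z j w < - c1] `|` Z j @^-1` AW.
  apply/seteqP; split => w /=.
    by rewrite /AW/=; case: (ltP (c * Z j w) (- c1)) => /=; [left|right].
  by case=> [lt|/andP[_ ->//]]; apply: (lt_trans lt); rewrite gtrN.
have dis : [set w | c * Z j w < - c1] `&` Z j @^-1` AW = set0.
  by apply/seteqP; split => // w [/=] + /andP[]; rewrite ltNge => /negP.
have := Theta_density h_gt0 j c1; rewrite -/c -/(F c1) F_split pWE.
rewrite [F (- c1)](esym (Theta_density h_gt0 j (- c1))).
change ((P [set w | c * Z j w < c1]%R = P [set w | c * Z j w < - c1]%R + pW%:E)%E ->
  P (Z j @^-1` AW) = pW%:E).
have finP : P [set w | c * Z j w < - c1] \is a fin_num by exact: fin_num_measure.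
have finQ : P (Z j @^-1` AW) \is a fin_num by apply: fin_num_measure; exact: mZ.
have PU : P [set w | c * Z j w < c1] =
    (P [set w | c * Z j w < - c1]%R + P (Z j @^-1` AW))%E.
  by rewrite E; apply: measureU => //; exact: mZ.
rewrite PU -(fineK finP) -(fineK finQ) -!EFinD => /eqP.
by rewrite eqe => /eqP/addrI ->.
Qed.

Definition small_weight_event (i : 'I_h) : set T :=
  (Z (wi i) @^-1` AW) `&` (Z (bi i) @^-1` AB).

Lemma measurable_small_weight_event i : measurable (small_weight_event i).
Proof. by apply: measurableI; exact: mZ. Qed.

(** Neuron [i] uses only the coordinates [i] and [h + i], so the events of [J] amount to [2 * #|J|]
    conditions on distinct independent coordinates. *)
Lemma small_weight_event_probability (J : {set 'I_h}) :
  P (\bigcap_(i in [set` J]) small_weight_event i) = ((pW * pB) ^+ #|J|)%:E.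
Proof.
pose JJ := (wi @: J :|: bi @: J)%SET.
pose B (j : 'I_(2 * h)) := if (j < h)%N then AW else AB.
have Bw i : B (wi i) = AW by rewrite /B /= ltn_ord.
have Bb i : B (bi i) = AB by rewrite /B /= ltnNge leq_addr.
have -> : \bigcap_(i in [set` J]) small_weight_event i =
    \bigcap_(j in [set` JJ]) (Z j @^-1` B j).
  apply/seteqP; split => w /= H.
    move=> j /=; rewrite inE => /orP[] /imsetP[i iJ ->].
      by rewrite Bw; exact: (H i iJ).1.
    by rewrite Bb; exact: (H i iJ).2.
  move=> i /= iJ; split.
    by rewrite -(Bw i); apply: H => /=; rewrite inE imset_f.
  by rewrite -(Bb i); apply: H => /=; rewrite inE imset_f ?orbT.
rewrite (Theta_indep h_gt0) => [|j _]; last by rewrite /B; case: ifP.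
rewrite (eq_bigr (fun j : 'I_(2 * h) => (if (j < h)%N then pW else pB)%:E)); last first.
  by move=> j _; rewrite /B; case: ifP => _; [exact: PAW|exact: PAB].
rewrite -(big_morph EFin EFinM erefl); congr EFin.
have dis : fintype.disjoint (mem (wi @: J)%SET) (mem (bi @: J)%SET).
  apply/pred0P => j /=; apply/negP => /andP[/imsetP[i _ ->] /imsetP[i' _ /(congr1 val)/=]].
  by have := ltn_ord i; lia.
rewrite (eq_bigl [predU (wi @: J)%SET & (bi @: J)%SET]) => [|j]; last by rewrite !inE.
rewrite bigU//= big_imset/=; last by move=> i i' _ _ /(congr1 val)/= e; exact: val_inj.
rewrite big_imset/=; last first.
  by move=> i i' _ _ /(congr1 val)/= /eqP; rewrite eqn_add2l => /eqP e; exact: val_inj.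
rewrite exprMn -!prodr_const; congr (_ * _); apply: eq_bigr => i _.
  by rewrite ltn_ord.
by rewrite ltnNge leq_addr.
Qed.

(** For [|x| < M] the scaled weight term is at most [c1 * M = eta / 2], while the scaled bias is
    below [- eta / 2]; the positive scale [c] divides out. *)
Lemma small_weight_event_dead i w : small_weight_event i w -> dead a b (Theta h w) i.
Proof.
move=> [/=]; rewrite /Z wiE biE /AW /AB /=.
set W := Theta h w 0 _; set B := Theta h w 0 _ => /andP[W1 W2] B1.
have key x : `|x| < M -> B + W * x < 0.
  move=> xM; rewrite -(pmulr_rlt0 _ c_gt0).
  have cW : `|c * W| <= c1 by rewrite ler_norml W1 ltW.
  have : c * W * x <= eta / 2.
    apply: (le_trans (ler_norm _)); rewrite normrM -c1M.
    by apply: ler_pM => //; exact: ltW.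
  by rewrite mulrDr mulrA; lra.
by split; apply: key; rewrite /M ltr_pwDr// le_max lexx ?orbT.
Qed.

End Width.

(** [pW * pB] is the same for all widths, because the density of the scaled parameters is, and so
    [p] can be chosen before [h]. *)
Lemma dead_neurons_probability : exists2 p, 0 < p <= 1 &
  forall h, (0 < h)%N -> exists2 C : set T, measurable C &
    (P C <= (9 * (1 - p) ^+ (h %/ 9))%:E)%E /\
    forall w, ~ C w -> exists2 A : {set 'I_h}, (9 <= #|A|)%N &
      forall i, i \in A -> dead a b (Theta h w) i.
Proof.
exists (pW * pB).
  apply/andP; split; first exact: mulr_gt0.
  exact: (event_probability_le1 (measurable_small_weight_event (h := 1))
    (small_weight_event_probability (ltn0Sn 0)) (ltn0Sn 0)).
move=> h h0; have [C mC [PC HC]] := few_events (measurable_small_weight_event (h := h))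
  (small_weight_event_probability h0).
exists C => //; split => // w /HC; set A := [set i | _]%SET => cA.
exists A => // i; rewrite inE => /asboolP; exact: small_weight_event_dead.
Qed.

End Initialization.

(** * Dead neurons and the generalized gradients *)

(** The zero map is the differential: the error term vanishes identically near [x]. *)
Lemma differentiable_near_cst (R : realFieldType) (V W : normedModType R)
    (F : V -> W) (x : V) (c : W) :
  (\forall y \near x, F y = c) -> differentiable F x.
Proof.
move=> Fc; have [d0 _] := dcst (F x) x.
have E : F \o shift x = cst (F x) + \0 +o_ 0 id.
  apply/eqaddoP => e e0.
  have /nbhs_ballP[r /= r0 H] := Fc.
  apply/nbhs_ballP; exists r => //= y; rewrite -ball_normE/= sub0r normrN => yr.
  have cx : F x = c by apply: H; exact: ballxx.
  have yx : F (y + x) = c.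
    by apply: H; rewrite -ball_normE/= opprD addrCA subrr addr0 normrN.
  change (`|F (y + x) - (F x + 0)| <= e * `|y|).
  by rewrite yx cx addr0 subrr normr0 mulr_ge0// ltW.
by apply/diff_locallyP; rewrite (diff_unique d0 E).
Qed.

Section DeadNeurons.
Context {R : realType}.
Variables (sigma : R -> R) (a b : R).
Hypothesis sigmaE : forall x, sigma x = Num.max x 0.

Lemma dead_sigma h (theta : 'rV[R]_(D h)) (i : 'I_h) x : dead a b theta i ->
  a <= x <= b -> sigma (theta 0 (in_bias i) + theta 0 (in_weight i) * x) = 0.
Proof.
move=> [da db] /andP[ax xb]; rewrite sigmaE; apply/max_idPr.
by have [w0|w0] := leP 0 (theta 0 (in_weight i)); nra.
Qed.

Lemma dead_inert h (theta : 'rV[R]_(D h)) (i : 'I_h) :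
  dead a b theta i -> inert sigma a b theta i.
Proof. by move=> di x xab; rewrite dead_sigma// mulr0. Qed.

(** The two inner parameters of neuron [i] enter only its own term, which vanishes for both
    parameter vectors. *)
Lemma network_dead_eq h (t t' : 'rV[R]_(D h)) (i : 'I_h) x :
  dead a b t i -> dead a b t' i ->
  (forall j, j != in_weight i -> j != in_bias i -> t 0 j = t' 0 j) ->
  a <= x <= b -> network sigma t x = network sigma t' x.
Proof.
move=> dt dt' tt' xab; have ih := ltn_ord i.
rewrite /network tt' -?(inj_eq val_inj) ?index_valE; first last.
- by apply/eqP; lia.
- by apply/eqP; lia.
congr (_ + _); apply: eq_bigr => j _; have jh := ltn_ord j.
have [->|ji] := eqVneq j i; first by rewrite !dead_sigma// !mulr0.
have {}ji : (j : nat) <> i by move=> /val_inj/eqP; exact/negP.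
have e k : val k <> (i : nat) -> val k <> (h + i)%N -> t 0 k = t' 0 k.
  move=> k1 k2; apply: tt'; rewrite -(inj_eq val_inj) index_valE; exact/eqP.
have -> : t 0 (out_weight j) = t' 0 (out_weight j) by apply: e; rewrite out_weight_val; lia.
have -> : t 0 (in_bias j) = t' 0 (in_bias j) by apply: e; rewrite in_bias_val; lia.
by have -> : t 0 (in_weight j) = t' 0 (in_weight j) by apply: e; rewrite in_weight_val; lia.
Qed.

Variables (T : Type) (X Y : nat -> T -> R) (M : nat).
Hypothesis Xab : forall m w, a <= X m w <= b.

Lemma empirical_risk_dead_eq h (t t' : 'rV[R]_(D h)) (i : 'I_h) w :
  dead a b t i -> dead a b t' i ->
  (forall j, j != in_weight i -> j != in_bias i -> t 0 j = t' 0 j) ->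
  empirical_risk sigma X Y M t w = empirical_risk sigma X Y M t' w.
Proof.
move=> dt dt' tt'; rewrite /empirical_risk; congr (_ * _).
by apply: eq_bigr => m _; rewrite (network_dead_eq dt dt' tt' (Xab m w)).
Qed.

Lemma in_weight_bias h (i i' : 'I_h) : (in_bias i == in_weight i') = false.
Proof.
rewrite -(inj_eq val_inj) !index_valE; apply/eqP.
by have := ltn_ord i'; lia.
Qed.

(** Deadness is an open condition, so the risk is constant for [psi] near the current inner
    parameters. *)
Lemma empirical_risk_differentiable h (theta : 'rV[R]_(D h)) (i : 'I_h) w :
  dead a b theta i ->
  differentiable (fun psi : R * R => empirical_risk sigma X Y M
      (replace2 theta (in_weight i) (in_bias i) psi) w)
    (theta 0 (in_weight i), theta 0 (in_bias i)).
Proof.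
move=> di; apply: (@differentiable_near_cst _ _ _ _ _ (empirical_risk sigma X Y M theta w)).
have near_lt y : theta 0 (in_bias i) + theta 0 (in_weight i) * y < 0 ->
    \forall psi \near (theta 0 (in_weight i), theta 0 (in_bias i)),
      psi.2 + psi.1 * y < 0.
  move=> lt0; have c : psi.2 + psi.1 * y @[psi --> (theta 0 (in_weight i), theta 0 (in_bias i))]
      --> theta 0 (in_bias i) + theta 0 (in_weight i) * y.
    apply: cvgD; first exact: cvg_snd.
    by apply: cvgM; [exact: cvg_fst|exact: cvg_cst].
  exact: (@cvgr_lt _ _ _ _ _ _ c _ lt0).
have [/near_lt na /near_lt nb] := di.
near=> psi; apply: (@empirical_risk_dead_eq _ _ _ i) => //.
- rewrite /dead !mxE !eqxx in_weight_bias; split.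
    by near: psi.
  by near: psi.
- by move=> j /negbTE j1 /negbTE j2; rewrite mxE j1 j2.
Unshelve. all: by end_near. Qed.

(** For small steps along the coordinate [j] the neuron stays dead, so the difference quotients are
    zero. *)
Lemma partial_dead_eq0 h (theta : 'rV[R]_(D h)) (i : 'I_h) (j : 'I_(D h)) w :
  dead a b theta i -> j = in_weight i \/ j = in_bias i ->
  partial (fun t => empirical_risk sigma X Y M t w) j theta = 0.
Proof.
move=> di ji; rewrite /partial /derive; apply: cvg_lim => //.
apply: cvg_near_cst; apply: cvg_within.
have near_lt y : theta 0 (in_bias i) + theta 0 (in_weight i) * y < 0 ->
    \forall s \near (0 : R), (s *: delta_mx 0 j + theta) 0 (in_bias i) +
       (s *: delta_mx 0 j + theta) 0 (in_weight i) * y < 0.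
  move=> lt0.
  have cc k : (s *: delta_mx 0 j + theta) 0 k @[s --> (0 : R)] --> theta 0 k.
    pose z : R := ((0 == 0 :> 'I_1) && (k == j))%:R.
    have -> : (fun s : R => (s *: delta_mx 0 j + theta) 0 k) = (fun s => s * z + theta 0 k).
      by apply/funext => s; rewrite 3!mxE.
    have H : s * z + theta 0 k @[s --> (0 : R)] --> 0 * z + theta 0 k.
      apply: cvgD; last exact: cvg_cst.
      by apply: cvgM; [exact: cvg_id|exact: cvg_cst].
    by rewrite mul0r add0r in H.
  have c : (s *: delta_mx 0 j + theta) 0 (in_bias i) +
       (s *: delta_mx 0 j + theta) 0 (in_weight i) * y @[s --> (0 : R)] -->
      theta 0 (in_bias i) + theta 0 (in_weight i) * y.
    by apply: cvgD; [exact: cc|apply: cvgM; [exact: cc|exact: cvg_cst]].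
  exact: (@cvgr_lt _ _ _ _ _ _ c _ lt0).
have [/near_lt na /near_lt nb] := di.
near=> s; rewrite /= (@empirical_risk_dead_eq _ _ theta i) ?subrr ?scaler0//.
- by split; near: s.
- move=> k k1 k2; rewrite !mxE (_ : (k == j) = false) ?andbF ?mulr0 ?add0r//.
  by apply/negbTE; case: ji => ->.
Unshelve. all: by end_near. Qed.

End DeadNeurons.

(** * Measurability and trajectories *)

Section Measurability.
Context {R : realType} {d : measure_display} {T : measurableType d}.
Variable P : probability T R.

Lemma random_vector_coord n (Z : T -> 'rV[R]_n.+1) j :
  random_vector Z -> measurable_fun setT (fun w => Z w 0 j).
Proof.
move=> mZ; apply: (measurability _ (RGenOInfty.measurableE R)) => //.
move=> /= _ [_ [x ->] <-]; rewrite setTI.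
have -> : (fun w => Z w 0 j) @^-1` `]x, +oo[ =
    Z @^-1` ((fun t : 'rV[R]_n.+1 => t 0 j) @^-1` `]x, +oo[) by [].
rewrite -[X in measurable X]setTI; apply: mZ => //.
apply: sub_gen_smallest; apply: open_comp; last exact: rray_open.
by move=> t _; exact: coord_continuous.
Qed.

Lemma measurable_network sigma h d' (T' : measurableType d') (Z : T' -> 'rV[R]_(D h))
    (X : T' -> R) : (forall x, sigma x = Num.max x 0) ->
  (forall j, measurable_fun setT (fun w => Z w 0 j)) -> measurable_fun setT X ->
  measurable_fun setT (fun w => network sigma (Z w) (X w)).
Proof.
move=> sigmaE mZ mX; apply: measurable_funD => //.
apply: measurable_sum => i; apply: measurable_funM => //.
have -> : sigma = (fun x => Num.max x 0) by apply/funext.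
apply: measurable_maxr; last exact: measurable_cst.
by apply: measurable_funD => //; apply: measurable_funM.
Qed.

(* [L (Z w)] is a partial integral over the second factor of [P \x P], hence
   measurable by Tonelli, without any continuity of [L]. *)
Lemma measurable_risk sigma h (Z : T -> 'rV[R]_(D h)) (X Y : T -> R)
    (L : 'rV[R]_(D h) -> R) : (forall x, sigma x = Num.max x 0) ->
  (forall j, measurable_fun setT (fun w => Z w 0 j)) ->
  measurable_fun setT X -> measurable_fun setT Y ->
  (forall theta, (L theta)%:E =
     \int[P]_w (`|network sigma theta (X w) - Y w| ^+ 2)%:E)%E ->
  measurable_fun setT (fun w => (L (Z w))%:E).
Proof.
move=> sigmaE mZ mX mY LE.
pose g (u : T * T) : \bar R := (`|network sigma (Z u.1) (X u.2) - Y u.2| ^+ 2)%:E.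
have -> : (fun w => (L (Z w))%:E) = fubini_F P g by apply/funext => w; rewrite LE.
apply: measurable_fun_fubini_tonelli_F => //; last by move=> u; rewrite lee_fin.
apply/measurable_EFinP; apply: measurable_funX; apply: measurableT_comp => //.
apply: measurable_funB; last by apply: measurableT_comp.
apply: (@measurable_network _ _ _ _ (fun u : T * T => Z u.1)) => //.
- by move=> j; apply: (measurableT_comp (mZ j)).
- by apply: measurableT_comp.
Qed.

Lemma measurable_limn_einf (u : nat -> T -> \bar R) :
  (forall n, measurable_fun setT (u n)) ->
  measurable_fun setT (fun w => limn_einf (u ^~ w)).
Proof.
move=> mu; rewrite (_ : (fun _ => _) = (fun w => - limn_esup (fun n => - u n w))%E).
  apply: measurableT_comp => //; apply: measurable_fun_limn_esup => n.
  exact: measurableT_comp.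
by apply/funext => w; rewrite -limn_einfN; congr limn_einf; apply/funext => n; rewrite /= oppeK.
Qed.

Lemma limn_einf_ge (u : nat -> \bar R) c : (forall n, c <= u n)%E ->
  (c <= limn_einf u)%E.
Proof.
move=> cu; rewrite limn_einf_lim; apply: lime_ge; first exact: is_cvg_einfs.
by apply: nearW => n; apply/ereal_infP => _ [m _ <-].
Qed.

End Measurability.

(** Clamping to [[a, b]] has Lipschitz constant [1]; it replaces [f] by a function continuous on the
    whole line with the same values on [[a, b]]. *)
Lemma lipschitz_clamp_continuous {R : realType} (f : R -> R) (a b : R) : a <= b ->
  [lipschitz f x | x in `[a, b]] ->
  continuous (fun x => f (Num.max a (Num.min x b))).
Proof.
move=> ab [M [_ HM]]; have := HM (M + 1); rewrite ltrDl ltr01 => /(_ isT) H.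
(* A strictly positive Lipschitz constant, so that [e / K] is a valid radius. *)
pose K := `|M + 1| + 1; have K0 : 0 < K by rewrite /K ltr_wpDl.
pose cl x := Num.max a (Num.min x b).
have clab x : `[a, b]%classic (cl x).
  by rewrite /= in_itv/= /cl le_max lexx/= ge_max ab ge_min lexx orbT.
have clK x y : `|cl x - cl y| <= `|x - y|.
  have h1 := ler_norm (x - y); have := ler_norm (y - x); rewrite distrC => h2.
  rewrite /cl /Num.max /Num.min ler_norml; apply/andP.
  case: (ltP x b) => ?; case: (ltP y b) => ?;
    case: (ltP a x) => ?; case: (ltP a y) => ?; case: (ltP a b) => ?; split; lra.
move=> x; apply/cvgrPdist_le => e e0.
have : \forall y \near x, ball x (e / K) y by apply: nbhsx_ballx; rewrite divr_gt0.
apply: filterS => y; rewrite /ball/= => xy.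
have /= := H (cl x, cl y) (conj (clab x) (clab y)); rewrite -!/(cl _) => le1.
apply: (le_trans le1); apply: (@le_trans _ _ (K * `|cl x - cl y|)).
  by rewrite ler_wpM2r// /K; have := ler_norm (M + 1); lra.
rewrite mulrC -ler_pdivlMr//; exact: le_trans (clK x y) (ltW xy).
Qed.

(** * Persistence of dead neurons along the trajectory *)

Section Trajectory.
Context {R : realType}.
Variables (sigma : R -> R) (a b : R) (Omega : Type).
Hypothesis sigmaE : forall x, sigma x = Num.max x 0.
Variables (X Y : nat -> nat -> Omega -> R) (M : nat -> nat) (h : nat).
Hypothesis Xab : forall n m w, a <= X n m w <= b.
Variable G : nat -> 'rV[R]_(D h) -> Omega -> 'rV[R]_(D h).
Hypothesis G_grad : forall (n : nat) (i : 'I_h) (j : 'I_(D h))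
     (theta : 'rV[R]_(D h)) (w : Omega),
     j = in_weight i \/ j = in_bias i ->
     differentiable
       (fun psi : R * R =>
          empirical_risk sigma (X n) (Y n) (M n)
            (replace2 theta (in_weight i) (in_bias i) psi) w)
       (theta 0 (in_weight i), theta 0 (in_bias i)) ->
     G n theta w 0 j =
     partial (fun t => empirical_risk sigma (X n) (Y n) (M n) t w) j theta.
Variable Theta : nat -> Omega -> 'rV[R]_(D h).
Variable Phi : forall n, ('I_n.+1 -> 'rV[R]_(D h)) -> 'rV[R]_(D h).
Hypothesis Phi0 : forall (n : nat) (g : 'I_n.+1 -> 'rV[R]_(D h)) (j : 'I_(D h)),
     \sum_(i < n.+1) `|g i 0 j| = 0 -> Phi g 0 j = 0.
Hypothesis Theta_step : forall (n : nat) (w : Omega),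
     Theta n.+1 w = Theta n w - Phi (fun k : 'I_n.+1 => G k (Theta k w) w).

(** A coordinate of [Phi] vanishes once all gradients so far vanish there, so the induction keeps
    the inner parameters of neuron [i] at their initial values at all times up to [n]. *)
Lemma dead_forever i w n : dead a b (Theta 0 w) i -> dead a b (Theta n w) i.
Proof.
move=> d0.
have same : forall k, (k <= n)%N ->
    Theta k w 0 (in_weight i) = Theta 0 w 0 (in_weight i) /\
    Theta k w 0 (in_bias i) = Theta 0 w 0 (in_bias i).
  elim: n => [k|n IHn k]; first by rewrite leqn0 => /eqP ->.
  rewrite leq_eqVlt => /predU1P[->|]; last by rewrite ltnS; exact: IHn.
  have dk (m : 'I_n.+1) : dead a b (Theta m w) i.
    have mn : (m <= n)%N by rewrite -ltnS.
    by rewrite /dead; have [-> ->] := IHn m mn.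
  have Phij j : j = in_weight i \/ j = in_bias i ->
      Phi (fun k : 'I_n.+1 => G k (Theta k w) w) 0 j = 0.
    move=> ji; apply: Phi0; rewrite big1// => m _.
    rewrite (G_grad ji); last exact: (empirical_risk_differentiable sigmaE).
    by rewrite (partial_dead_eq0 sigmaE _ _ _ _ (dk m) ji) ?normr0.
  have [e1 e2] := IHn n (leqnn n).
  by rewrite Theta_step !mxE !Phij ?subr0; [|right|left].
by rewrite /dead; have [-> ->] := same n (leqnn n).
Qed.

End Trajectory.

(** * From the uniform risk gap to the probability bound *)

Theorem corollary4p7
  (R : realType)
  (a b : R) (hab : a <= b)
  (mu : {measure set R -> \bar R})
  (f : R -> R)
  (f_bounded : [bounded f x | x in `[a, b]])
  (f_measurable : measurable_fun `[a, b] f)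
  (sigma : R -> R)
  (sigmaE : forall x, sigma x = Num.max x 0)
  (risk_real : forall (h : nat) (theta : 'rV[R]_(D h)),
     risk sigma a b mu f theta \is a fin_num)
  (* generalized stochastic gradient method *)
  (d : measure_display) (Omega : measurableType d) (P : probability Omega R)
  (X Y : nat -> nat -> {RV P >-> R})
  (X_range : forall n m w, X n m w \in `[a, b])
  (M : nat -> nat -> nat)
  (M_gt0 : forall h n, (0 < M h n)%N)
  (G : forall h, nat -> 'rV[R]_(D h) -> Omega -> 'rV[R]_(D h))
  (G_grad : forall (h n : nat) (i : 'I_h) (j : 'I_(D h))
     (theta : 'rV[R]_(D h)) (w : Omega),
     j = in_weight i \/ j = in_bias i ->
     differentiable
       (fun psi : R * R =>
          empirical_risk sigma (X n) (Y n) (M h n)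
            (replace2 theta (in_weight i) (in_bias i) psi) w)
       (theta 0 (in_weight i), theta 0 (in_bias i)) ->
     G h n theta w 0 j =
     partial (fun t => empirical_risk sigma (X n) (Y n) (M h n) t w) j theta)
  (Theta : forall h, nat -> Omega -> 'rV[R]_(D h))
  (Theta_rv : forall h n, random_vector (Theta h n))
  (Phi : forall h n, ('I_n.+1 -> 'rV[R]_(D h)) -> 'rV[R]_(D h))
  (Phi0 : forall (h n : nat) (g : 'I_n.+1 -> 'rV[R]_(D h)) (j : 'I_(D h)),
     \sum_(i < n.+1) `|g i 0 j| = 0 -> Phi h n g 0 j = 0)
  (Theta_step : forall (h n : nat) (w : Omega),
     Theta h n.+1 w =
     Theta h n w - Phi h n (fun k : 'I_n.+1 => G h k (Theta h k w) w))
  (* true risk *)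
  (L : forall h, 'rV[R]_(D h) -> R)
  (LE : forall h, (0 < h)%N -> forall theta : 'rV[R]_(D h),
     (L h theta)%:E =
     'E_P[fun w => (`|network sigma theta (X 0%N 0%N w) - Y 0%N 0%N w| ^+ 2)%R]%E)
  (* assumptions on the data *)
  (f_lipschitz : [lipschitz f x | x in `[a, b]])
  (Y_cond : cond_exp_ae_eq P (Y 0%N 0%N) (X 0%N 0%N) (fun w => f (X 0%N 0%N w)))
  (X_law : forall B : set R, measurable B -> B `<=` `[a, b] ->
     P (X 0%N 0%N @^-1` B) = mu B)
  (* assumptions on the initialization *)
  (Theta_indep : forall h, (0 < h)%N ->
     independent_family P
       (fun (i : 'I_(2 * h)) w => Theta h 0%N w 0 (inner_param i)))
  (q : R -> R) (q_ge0 : forall x, 0 <= q x) (q_meas : measurable_fun setT q)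
  (eta : R) (eta_gt0 : 0 < eta)
  (q_pos : `]- eta, eta[ `<=` q @^-1` `]0, +oo[)
  (kappa : R)
  (Theta_density : forall h, (0 < h)%N -> forall (i : 'I_(2 * h)) (x : R),
     P [set w | h%:R `^ kappa * Theta h 0%N w 0 (inner_param i) < x] =
     (\int[lebesgue_measure]_(y in `]-oo, x[) (q y)%:E)%E)
  (not_attained : forall h, (0 < h)%N ->
     ~ range (fun theta : 'rV[R]_(D h) => (L h theta)%:E)
         ('E_P[fun w => (`|f (X 0%N 0%N w) - Y 0%N 0%N w| ^+ 2)%R])%E) :
  exists delta : R, 0 < delta /\
    forall h, (0 < h)%N ->
      (P [set w | limn_einf (fun n => (L h (Theta h n w))%:E) =
                  ereal_inf (range (fun theta : 'rV[R]_(D h) =>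
                                      (L h theta)%:E))]
       <= (delta^-1 * expR (- delta * h%:R))%:E)%E.
Proof.
pose X0 := X 0%N 0%N; pose Y0 := Y 0%N 0%N.
have Xab n m w : a <= X n m w <= b by have := X_range n m w; rewrite ?inE/= ?in_itv.
have mX0 : measurable_fun setT X0 by exact: measurable_funPT.
have mY0 : measurable_fun setT Y0 by exact: measurable_funPT.
pose ft x := f (Num.max a (Num.min x b)).
have cft : continuous ft by exact: lipschitz_clamp_continuous.
have ftX w : ft (X0 w) = f (X0 w).
  have /andP[aX Xb] := Xab 0%N 0%N w.
  by rewrite /ft /X0 (min_idPl Xb) (max_idPr aX).
have LE' h (h0 : (0 < h)%N) theta : ((L h theta)%:E =
    \int[P]_w (`|network sigma theta (X0 w) - Y0 w| ^+ 2)%:E)%E.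
  by rewrite LE// unlock.
have msq (g : R -> R) : continuous g -> measurable_fun setT (fun w => (g (X0 w) - Y0 w) ^+ 2).
  move=> cg; apply: measurable_funX; apply: measurable_funB => //.
  exact: measurable_continuous_comp.
have iN h (h0 : (0 < h)%N) (theta : 'rV[R]_(D h)) :
    P.-integrable setT (EFin \o (fun w => (network sigma theta (X0 w) - Y0 w) ^+ 2)).
  apply/integrableP; split.
    by apply/measurable_EFinP; apply: msq; exact: network_continuous.
  rewrite (_ : (\int[P]_w _)%E = (L h theta)%:E) ?ltry//.
  rewrite LE'//; apply: eq_integral => w _ /=.
  by rewrite ger0_norm ?sqr_ge0// real_normK ?num_real.
have Lmse h (h0 : (0 < h)%N) (theta : 'rV[R]_(D h)) :
    L h theta = mse P X0 Y0 (network sigma theta).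
  have /(congr1 fine) /= -> := LE' h h0 theta; congr fine.
  by apply: eq_integral => w _; rewrite real_normK ?num_real.
have [V [iY0 _ iV VY] Vf] := Y_cond.
have iYf : P.-integrable setT (EFin \o (fun w => ft (X0 w))).
  exact: (rint_continuous _ mX0 (Xab 0%N 0%N)).
(* [V] is a version of the conditional expectation and equals [f(X0)] almost surely, so [f(X0)] and
   [Y0] have the same integral over every event determined by [X0]. *)
have CE B : measurable B -> \int[P]_(w in X0 @^-1` B) (Y0 w - ft (X0 w)) = 0.
  move=> mB; have mXB : measurable (X0 @^-1` B).
    by rewrite -[X in measurable X]setTI; exact: mX0.
  rewrite RintegralB//; try exact: (integrableS measurableT).
  apply/eqP; rewrite subr_eq0; apply/eqP; rewrite /Rintegral -VY//; congr fine.
  apply: ae_eq_integral => //.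
  - by apply: measurable_funTS; exact: measurable_int iV.
  - by apply: measurable_funTS; exact: measurable_int iYf.
  - by apply: filterS Vf => w Vw _ /=; rewrite Vw ftX.
(* A network equal to the target almost surely would attain the value excluded by [not_attained]. *)
have nonet h (theta : 'rV[R]_(D h)) : (0 < h)%N ->
    ~ {ae P, forall w, network sigma theta (X0 w) = ft (X0 w)}.
  move=> h0 Hae; apply: (not_attained h h0); exists theta => //=.
  rewrite LE'// unlock; apply: ae_eq_integral => //.
  - apply/measurable_EFinP; apply: measurable_funX; apply: measurableT_comp => //.
    apply: measurable_funB => //.
    by apply: measurable_continuous_comp => //; exact: network_continuous.
  - apply/measurable_EFinP; apply: measurable_funX; apply: measurableT_comp => //.
    apply: measurable_funB => //.
    rewrite (_ : (fun w => _) = fun w => ft (X0 w)); last by apply/funext => w.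
    exact: measurable_continuous_comp.
  - by apply: filterS Hae => w Hw _ /=; rewrite Hw ftX.
have mT h n j : measurable_fun setT (fun w => Theta h n w 0 j).
  exact: random_vector_coord.
have [p /andP[p0 p1] HC] := dead_neurons_probability (fun h => mT h 0%N) Theta_indep
   a b q_ge0 q_meas eta_gt0 q_pos Theta_density.
have [delta delta0 Hdelta] := geometric_le_exp p0 p1.
exists delta; split => // h h0.
have [C mC [PC deadC]] := HC h h0.
have [eps eps0 improve] := inert_improvement mX0 (Xab 0%N 0%N) iY0 cft CE sigmaE nonet h.
set inf := ereal_inf _.
(* Finiteness makes [inf + eps%:E] strictly larger than [inf]. *)
have inf_fin : inf \is a fin_num.
  rewrite ge0_fin_numE.
    by apply: (@le_lt_trans _ _ (L h 0)%:E); [apply: ereal_inf_lbound; exists 0|rewrite ltry].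
  by apply/ereal_infP => _ [theta _ <-]; rewrite lee_fin Lmse// Rintegral_ge0// => w _; exact: sqr_ge0.
(* Outside [C] at least nine neurons are dead at every time [n], and the improved parameter has risk
   at least [inf]; hence a gap uniform in [n]. *)
have gap w n : ~ C w -> (inf + eps%:E <= (L h (Theta h n w))%:E)%E.
  move=> /deadC[A cA dA].
  have [|theta' H] := improve (Theta h n w) A (iN h h0 _) _ cA.
    move=> i iA; apply: dead_inert => //.
    exact: (dead_forever sigmaE Xab (G_grad h) (Phi0 h) (Theta_step h) n (dA i iA)).
  apply: (@le_trans _ _ ((L h theta')%:E + eps%:E)%E).
    by rewrite leeD2r//; apply: ereal_inf_lbound; exists theta'.
  by rewrite -EFinD lee_fin !Lmse// -lerBrDr.
(* Outside [C] the lower limit is at least [inf + eps%:E], so the event is contained in [C]. *)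
apply: (@le_trans _ _ (P C)); last by apply: (le_trans PC); rewrite lee_fin.
apply: le_measure; rewrite ?inE//.
  have mlim : measurable_fun setT (fun w => limn_einf (fun n => (L h (Theta h n w))%:E)).
    apply: measurable_limn_einf => n.
    exact: (measurable_risk sigmaE (mT h n) mX0 mY0 (LE' h h0)).
  by have := mlim measurableT _ (emeasurable_set1 inf); rewrite setTI.
move=> w /= Hw; apply: contrapT => nC.
have := limn_einf_ge (fun n => gap w n nC); rewrite Hw.
by rewrite -(fineK inf_fin) -EFinD lee_fin; lra.
Qed.
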